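(* Let $S$ be a nonempty, closed and convex subset of a Banach algebra $E$ satisfying condition $(\mathcal{P})$. Suppose that $A, B, C : S \to \mathcal{P}(E)$ are three multi-valued mappings with weakly sequentially closed graphs such that: (i) for each $u\in S$, $A(u)\cdot B(u)+C(u)$ is a closed, convex subset of $S$; (ii) there exists a bounded set $\Omega$ belonging to the family $\{S^{A\cdot B+C}_n : n\in\mathbb{N}\}$; (iii) $A, B$ and $C$ are countably $\mathcal{D}$-set-Lipschitzian on $\Omega$ with $\mathcal{D}$-functions $\Phi_A, \Phi_B$ and $\Phi_C$ respectively; (iv) $A(\Omega)$ and $B(\Omega)$ are bounded. Then the operator inclusion $x\in A(x)\cdot B(x)+C(x)$ has at least one solution in $\Omega$, provided that $$\|B(\Omega)\|\Phi_A(r)+\|A(\Omega)\|\Phi_B(r)+\Phi_A(r)\Phi_B(r)+\Phi_C(r)< r\quad\text{for } 0< r\leq \|\Omega\|.$$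
   Context: $\mathcal{P}(E)$ is the family of all nonempty subsets of $E$. For a multi-valued $F$ on $S$ and $M\subset S$, $F(M)=\bigcup_{x\in M}F(x)$. For $M\subset E$, $\|M\|=\sup\{\|x\|:x\in M\}$. $A(u)\cdot B(u)+C(u)=\{ab+c: a\in A(u), b\in B(u), c\in C(u)\}$. $\rightharpoonup$ denotes weak convergence. $\mathbb N$ includes $0$. Condition $(\mathcal P)$ for a Banach algebra $E$: whenever $\alpha_n\rightharpoonup\alpha$ and $\beta_n\rightharpoonup\beta$ in $E$, then $\alpha_n\cdot\beta_n\rightharpoonup\alpha\cdot\beta$. For $T:S\to\mathcal P(S)$, the sequence $(S^T_n)$ is defined by $S^T_0=S$, $S^T_{n+1}=\overline{co}(T(S^T_n))$ (closed convex hull); here $T=A\cdot B+C: u\mapsto A(u)\cdot B(u)+C(u)$. $F:S\to\mathcal P(E)$ has a weakly sequentially closed graph if whenever $x_n\in S$, $x_n\rightharpoonup x\in S$, $y_n\in F(x_n)$ and $y_n\rightharpoonup y$ in $E$, then $y\in F(x)$. $\beta$ is the De Blasi measure of weak noncompactness: for bounded $W\subset E$, $\beta(W)=\inf\{\varepsilon>0:\ \exists K\subset E \text{ weakly compact},\ W\subset K+\mathcal{B}_E(\varepsilon)\}$, where $\mathcal{B}_E(\varepsilon)$ is the closed ball of radius $\varepsilon$ centred at the origin. $F$ is countably $\mathcal{D}$-set-Lipschitzian on $\Omega$ with $\mathcal{D}$-function $\Phi$ if $\Phi:\mathbb{R}_+\to\mathbb{R}_+$ is continuous, nondecreasing, $\Phi(0)=0$,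 and $\beta(F(W))\le\Phi(\beta(W))$ for every countable bounded subset $W$ of $\Omega$ with $F(W)$ bounded. *)

(* Defs.v *)
From HB Require Import structures.
From mathcomp Require Import all_boot all_order all_algebra.
From mathcomp Require Import all_classical all_reals all_analysis.

Set Implicit Arguments.
Unset Strict Implicit.
Unset Printing Implicit Defensive.

Import Order.TTheory GRing.Theory Num.Theory.
Import numFieldTopology.Exports numFieldNormedType.Exports.

Local Open Scope classical_set_scope.
Local Open Scope ring_scope.

(* Banach algebras are neither assumed unital nor commutative, so the product
   is not the one of a MathComp ring structure. *)
HB.mixin Record CompleteNormedModule_isBanachAlgebra (K : numFieldType) E
    & CompleteNormedModule K E := {
  bmul : E -> E -> E ;
  bmulA : forall x y z, bmul x (bmul y z) = bmul (bmul x y) z ;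
  bmul_linearl : forall (k : K) x y z,
    bmul (k *: x + y) z = k *: bmul x z + bmul y z ;
  bmul_linearr : forall (k : K) x y z,
    bmul z (k *: x + y) = k *: bmul z x + bmul z y ;
  ler_normM_bmul : forall x y, `|bmul x y| <= `|x| * `|y|
}.

#[short(type="banachAlgType")]
HB.structure Definition BanachAlgebra (K : numFieldType) :=
  {E of CompleteNormedModule K E & CompleteNormedModule_isBanachAlgebra K E}.

Notation "x *b y" := (bmul x y)
  (at level 40, left associativity) : ring_scope.

Definition continuous_dual (R : realType) (E : normedModType R) : Type :=
  {f : {linear E -> R^o} | continuous f}.

(* [weak E] is [E] carrying the coarsest topology that makes every element of
   the continuous dual continuous. *)
Definition weak (R : realType) (E : normedModType R) : Type :=
  sup_topology (fun f : continuous_dual E =>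
    Topological.class (initial_topology (projT1 f : E -> R^o))).

HB.instance Definition _ (R : realType) (E : normedModType R) :=
  Topological.on (weak E).

Definition weakly_cvg (R : realType) (E : normedModType R)
    (u : nat -> E) (x : E) : Prop :=
  (u : nat -> weak E) @ \oo --> (x : weak E).

Lemma weakly_cvgP (R : realType) (E : normedModType R) (u : nat -> E) (x : E) :
  weakly_cvg u x <->
  forall f : {linear E -> R^o}, continuous f -> f \o u @ \oo --> f x.
Proof.
split=> [|ux].
  move=> /cvg_sup ux f cf B /= /(@initial_continuous E R^o f x) fB.
  exact: (ux (exist _ f cf) _ fB).
apply/cvg_sup => -[f cf] B [_ [[C Cop <-] Cfx] CB].
have /(ux f cf) fC : nbhs (f x : R^o) C by apply: open_nbhs_nbhs; split.
by apply: (@filterS _ \oo _ _ _ _ fC) => n /= ?; exact: CB.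
Qed.

Definition weakly_compact (R : realType) (E : normedModType R)
    (K : set E) : Prop :=
  compact (K : set (weak E)).

Definition condition_P (R : realType) (E : banachAlgType R) : Prop :=
  forall (a b : nat -> E) (x y : E),
    weakly_cvg a x -> weakly_cvg b y ->
    weakly_cvg (fun n => a n *b b n) (x *b y).

Definition set_norm (R : realType) (E : normedModType R) (M : set E) : R :=
  sup [set `|x| | x in M].

(* A multi-valued mapping on [S] is a function [F : E -> set E] whose values
   outside [S] are irrelevant. *)
Definition multivalued (R : realType) (E : normedModType R)
    (S : set E) (F : E -> set E) : Prop :=
  forall x, S x -> F x !=set0.

Definition mv_image (R : realType) (E : normedModType R)
    (F : E -> set E) (M : set E) : set E :=
  \bigcup_(x in M) F x.

Definition mv_mul_add (R : realType) (E : banachAlgType R)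
    (A B C : E -> set E) (u : E) : set E :=
  [set z | exists a b c, [/\ A u a, B u b, C u c & z = a *b b + c]].

Definition is_convex (R : realType) (E : normedModType R) (M : set E) : Prop :=
  convex_set (M : set (convex_lmodType E)).

Definition closed_convex_hull (R : realType) (E : normedModType R)
    (M : set E) : set E :=
  smallest [set N : set E | closed N /\ is_convex N] M.

Fixpoint hull_seq (R : realType) (E : normedModType R)
    (S : set E) (T : E -> set E) (n : nat) : set E :=
  if n is m.+1 then closed_convex_hull (mv_image T (hull_seq S T m)) else S.

Definition weakly_seq_closed_graph (R : realType) (E : normedModType R)
    (S : set E) (F : E -> set E) : Prop :=
  forall (x_ y_ : nat -> E) (x y : E),
    (forall n, S (x_ n)) -> S x -> weakly_cvg x_ x ->
    (forall n, F (x_ n) (y_ n)) -> weakly_cvg y_ y ->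
    F x y.

(* De Blasi's measure of weak noncompactness. *)
Definition de_blasi (R : realType) (E : normedModType R) (W : set E) : R :=
  inf [set e : R | 0 < e /\ exists K : set E, weakly_compact K /\
    W `<=` [set k + b | k in K & b in closed_ball (0 : E) e]].

(* A function from [0, +oo[ to itself, represented by a function on [R] whose
   values on negative numbers are irrelevant. *)
Definition D_function (R : realType) (Phi : R -> R) : Prop :=
  [/\ forall r, 0 <= r -> 0 <= Phi r,
      {within `[0, +oo[, continuous Phi},
      {in `[0, +oo[ &, {homo Phi : r s / r <= s}} &
      Phi 0 = 0].

Definition countably_D_set_Lipschitzian (R : realType) (E : normedModType R)
    (Omega : set E) (F : E -> set E) (Phi : R -> R) : Prop :=
  D_function Phi /\
  forall W : set E, W `<=` Omega -> countable W ->
    bounded_set W -> bounded_set (mv_image F W) ->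
    de_blasi (mv_image F W) <= Phi (de_blasi W).

(* Main.v *)
From HB Require Import structures.
Require Import Defs.
From mathcomp Require Import all_boot zify.

(**
   Choose single-valued selections a, b, c of A, B, C on S, put t = a b + c, and
   let D be the least subset of Omega that contains a given point and is closed
   under t and midpoints.  D is countable and, by minimality, contained in the
   convex hull of t(D) and that point.  Hence covers of a(D), b(D), c(D) by small
   enlargements of weakly compact sets give such a cover of D: the products of
   countably many points of these weakly compact sets form a relatively weakly
   compact set by condition (P) and the Eberlein-Smulian theorem, and so does
   its convex hull by Krein's theorem.  The growth condition then forces the
   measure of weak noncompactness of D to vanish, so D, A(D), B(D) and C(D) are
   relatively weakly compact.

   As D is countable, countably many forms separate the points of its closed
   convex hull.  For each n, Scarf's combinatorial lemma, applied to colourings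
   of the lattice points of a simplex, gives a convex combination of points
   t(q), with q in D, that is within 1/n of each of these q for the first n
   forms.  A subsequence of these approximate fixed points converges weakly, and
   the closed graphs together with the separation theorem show that the limit y
   satisfies y in A(y) B(y) + C(y).
*)

Set Implicit Arguments.
Unset Strict Implicit.
Unset Printing Implicit Defensive.

(** * Scarf's lemma *)

(** The measure is controlled on countable sets only, so compactness has to come from one countable
    set that [t] maps into itself. Closing [D] under midpoints rather than under all convex
    combinations keeps it countable, and its closure is still convex.

    The selections are arbitrary, so [t] has no continuity and need not have a fixed point. Scarf's
    lemma asks for none: any colouring of the lattice points is allowed, and it returns one lattice
    point with neighbours of all the colours in its support. What survives in the limit is that [y]
    is approached by averages of values [t q] at points [q] that themselves approach [y] weakly.
    Convexity of A(y) B(y) + C(y) lets separation turn this into membership. *)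

Lemma collision (T U : finType) (f : T -> U) (A : {set T}) :
  #|A| = #|f @: A|.+1 ->
  exists x y, [/\ x \in A, y \in A, x != y & f x = f y] /\
    [/\ f @: (A :\ x) = f @: A, f @: (A :\ y) = f @: A,
     {in A :\ x &, injective f} &
     forall z, z \in A -> f @: (A :\ z) = f @: A -> z = x \/ z = y].
Proof.
move=> cA.
have [x [y [xA yA xy fxy]]] : exists x y, [/\ x \in A, y \in A, x != y & f x = f y].
  have : ~~ [forall x in A, forall y in A, (f x == f y) ==> (x == y)].
    apply/negP => /forall_inP H.
    have inj : {in A &, injective f}.
      move=> x y xA yA fxy; have /forall_inP /(_ y yA) := H x xA.
      by rewrite fxy eqxx /= => /eqP.
    by have := card_in_imset inj; rewrite cA => /eqP; rewrite eqn_leq ltnn andbF.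
  rewrite negb_forall_in => /existsP [x /andP [xA]].
  rewrite negb_forall_in => /existsP [y /andP [yA]].
  by rewrite negb_imply => /andP [/eqP fxy xy]; exists x, y.
have imD u v : u != v -> v \in A -> f u = f v -> f @: (A :\ u) = f @: A.
  move=> uv vA fuv; apply/eqP; rewrite eqEsubset; apply/andP; split.
    by apply: imsetS; apply: subsetDl.
  apply/subsetP => _ /imsetP [z zA ->].
  have [->|zu] := eqVneq z u; last by apply: imset_f; rewrite !inE zu.
  by rewrite fuv; apply: imset_f; rewrite !inE eq_sym uv.
have injx : {in A :\ x &, injective f}.
  apply/imset_injP; rewrite (imD x y) //.
  by have := cardsD1 x A; rewrite xA cA add1n => -[->].
exists x, y; split=> //; split=> //.
- exact: imD xy yA fxy.
- by apply: imD xA (esym fxy); rewrite eq_sym.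
move=> z zA fz.
have [->|zx] := eqVneq z x; first by left.
right; apply: (injx z y); rewrite ?inE ?zx ?zA // 1?eq_sym ?xy //.
have : f z \in f @: (A :\ z) by rewrite fz imset_f.
move=> /imsetP [w]; rewrite !inE => /andP [wz wA] fzw.
have [wx|wx] := eqVneq w x; first by rewrite fzw wx.
by move: wz; rewrite (injx w z) ?inE ?wx ?zx ?eqxx.
Qed.

Section Scarf.
Variables (I X : finType) (r : I -> X -> nat).
Hypothesis r_inj : forall i, injective (r i).
Implicit Types (s t : {set X}) (C B : {set I}).

(** Scarf's dominance: no point of [X] exceeds the least element of [s] in all the orders of [C] at
    once. *)
Definition dominant s C :=
  [forall x, exists i in C, forall y in s, r i x <= r i y].

Lemma dominantP s C :
  reflect (forall x, exists2 i, i \in C & forall y, y \in s -> r i x <= r i y)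
          (dominant s C).
Proof.
apply: (iffP forallP) => [H x|H x].
  have /existsP [i /andP [iC /forallP Hi]] := H x.
  by exists i => // y ys; have := Hi y; rewrite ys.
have [i iC Hi] := H x; apply/existsP; exists i; rewrite iC /=.
by apply/forallP => y; apply/implyP; exact: Hi.
Qed.

(* Rooms are the cells of Scarf's abstract triangulation, doors their facets. *)
Definition is_room (d : {set X} * {set I}) := dominant d.1 d.2 && (#|d.1| == #|d.2|).
Definition is_door (d : {set X} * {set I}) := dominant d.1 d.2 && (#|d.2| == #|d.1|.+1).
Definition incident (d e : {set X} * {set I}) := (d.1 \subset e.1) && (e.2 \subset d.2).

Definition argm s i x0 := [arg min_(x < x0 in s) r i x].

(** [B] has one more order than [t] has points, and dominance makes the map [m] to the minima onto,
    so [m] identifies exactly one pair [j], [k]. Freeing the door from either order [l] of the pair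
    gives a room: a point of [Q l] enters if there is one, and otherwise [l] is dropped. *)
Lemma door_rooms t B : is_door (t, B) -> t != set0 ->
  #|[set e | is_room e && incident (t, B) e]| = 2.
Proof.
move=> /andP [/= tB /eqP cB] /set0Pn [x0 x0t].
pose m i := argm t i x0.
have mt i : m i \in t by rewrite /m /argm; case: arg_minnP.
have m_min i y : y \in t -> r i (m i) <= r i y.
  by rewrite /m /argm; case: arg_minnP => //= x _ + yt; apply.
have m_eq i y : y \in t -> (forall z, z \in t -> r i y <= r i z) -> y = m i.
  move=> yt H; apply: (r_inj (i := i)); apply/eqP; rewrite eqn_leq m_min // andbT.
  exact: H.
have dom_surj C : dominant t C -> t \subset [set m i | i in C].
  move=> /dominantP tC; apply/subsetP => y yt.
  have [i iC Hi] := tC y; apply/imsetP; exists i => //; exact: m_eq.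
have imB : [set m i | i in B] = t.
  apply/eqP; rewrite eqEsubset dom_surj // andbT.
  by apply/subsetP => _ /imsetP [i _ ->].
have [|j [k [[jB kB jk mjk] [imBj imBk injBj only]]]] := @collision _ _ m B.
  by rewrite imB cB.
rewrite {}imB in imBj imBk only.
have mj_only i : i \in B -> m i = m j -> i = j \/ i = k.
  move=> iB mij; have [->|ij] := eqVneq i j; first by left.
  right; apply: injBj; rewrite ?inE ?ij ?iB //; first by rewrite eq_sym jk.
  by rewrite mij.
have rel_jk i : i \in B -> t \subset [set m i' | i' in B :\ i] -> i = j \/ i = k.
  move=> iB sub; apply: only => //; apply/eqP; rewrite eqEsubset sub andbT.
  by apply/subsetP => _ /imsetP [i' _ ->].
pose Q l := [set x | [forall i in B :\ l, r i (m i) < r i x]].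
have QP l x : reflect (forall i, i \in B -> i != l -> r i (m i) < r i x) (x \in Q l).
  rewrite inE; apply: (iffP forall_inP) => H i.
    by move=> iB il; apply: H; rewrite !inE il.
  by rewrite !inE => /andP [il iB]; apply: H.
have surj l : (l == j) || (l == k) -> forall y, y \in t -> exists2 i, i \in B :\ l & y = m i.
  by move=> /orP [] /eqP -> y yt; apply/imsetP; rewrite ?imBj ?imBk.
(* The room on the side of [l]: its new vertex is the [r l]-largest of the points
   that no order of [B] other than [l] bounds. *)
pose rm l : {set X} * {set I} :=
  if [pick x in Q l] is Some x1 then ([arg max_(x > x1 in Q l) r l x] |: t, B)
  else (t, B :\ l).
have Qnt l x : (l == j) || (l == k) -> x \in Q l -> x \notin t.
  move=> ljk /QP xQ; apply/negP => /(surj l ljk) [i]; rewrite !inE => /andP [il iB] xm.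
  by have := xQ i iB il; rewrite xm ltnn.
have Qlt l x : (l == j) || (l == k) -> x \in Q l -> r l x < r l (m l).
  move=> ljk xQ; move/dominantP: tB => /(_ x) [i iB Hi].
  have [il|il] := eqVneq i l.
    rewrite -il ltn_neqAle Hi ?mt // andbT.
    apply/eqP => /r_inj xm; move: (Qnt l x ljk xQ); by rewrite xm mt.
  by move/QP: xQ => /(_ i iB il); rewrite ltnNge Hi ?mt.
have lB l : (l == j) || (l == k) -> l \in B by move=> /orP [] /eqP ->.
have rm_room l : (l == j) || (l == k) -> is_room (rm l) && incident (t, B) (rm l).
  move=> ljk; rewrite /rm; case: pickP => [x1 x1Q|Q0].
    case: arg_maxnP => //= x xQ xmax.
    rewrite /is_room /incident /= subsetUr subxx !andbT.
    rewrite cardsU1 (Qnt l x ljk xQ) cB add1n eqxx andbT.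
    apply/dominantP => y; have [yQ|] := boolP (y \in Q l).
      exists l; first exact: lB.
      move=> z; rewrite !inE => /orP [/eqP ->|zt]; first exact: xmax.
      apply: leq_trans (xmax y yQ) _; apply: ltnW; apply: leq_trans (Qlt l x ljk xQ) _.
      exact: m_min.
    rewrite inE negb_forall_in => /existsP [i /andP []].
    rewrite !inE => /andP [il iB] yi; rewrite -leqNgt in yi.
    exists i => // z; rewrite !inE => /orP [/eqP ->|zt].
      apply: leq_trans yi _; apply: ltnW; by move/QP: xQ; apply.
    by apply: leq_trans yi _; apply: m_min.
  rewrite /is_room /incident /= subxx subsetDl !andbT.
  have := cardsD1 l B; rewrite lB // cB add1n => -[<-]; rewrite eqxx andbT.
  apply/dominantP => y; have := Q0 y; rewrite inE /= => /negbT.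
  rewrite negb_forall_in => /existsP [i /andP [iBl yi]]; rewrite -leqNgt in yi.
  by exists i => // z zt; apply: leq_trans yi _; apply: m_min.
have rm_uniq e : is_room e -> incident (t, B) e -> e = rm j \/ e = rm k.
  suff: is_room e -> incident (t, B) e -> exists2 l, (l == j) || (l == k) & e = rm l.
    by move=> H h1 h2; have [l /orP [] /eqP -> ->] := H h1 h2; [left|right].
  case: e => s C /andP [/= sC /eqP csC] /andP [/= ts CB].
  have := subset_leq_card ts; rewrite leq_eqVlt => /orP [/eqP cts|cts].
    have st : s = t by apply/esym/eqP; rewrite eqEcard ts cts leqnn.
    subst s.
    have [l lB' ClB] : exists2 l, l \in B & C = B :\ l.
      have : #|B :\: C| == 1 by rewrite cardsD (setIidPr CB) cB csC subSn // subnn.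
      move=> /cards1P [l Bl]; have : l \in B :\: C by rewrite Bl set11.
      rewrite inE => /andP [lC lB']; exists l => //.
      by rewrite -Bl setDDr setDv set0U (setIidPr CB).
    exists l.
      have [|->|->] := rel_jk l lB'; rewrite ?eqxx ?orbT // -ClB; exact: dom_surj.
    rewrite /rm; case: pickP => [x1 /QP x1Q|_]; last by rewrite ClB.
    move/dominantP: sC => /(_ x1) [i]; rewrite ClB !inE => /andP [il iB] /(_ (m i) (mt i)).
    by rewrite leqNgt x1Q.
  have cC : #|C| = #|B|.
    apply/eqP; rewrite eqn_leq subset_leq_card //= cB -csC //.
  have CBe : C = B by apply/eqP; rewrite eqEcard CB cC leqnn.
  subst C.
  have : #|s :\: t| == 1 by rewrite cardsD (setIidPr ts) csC cB subSn // subnn.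
  move=> /cards1P [x sx].
  have : x \in s :\: t by rewrite sx set11.
  rewrite inE => /andP [xt xs].
  have sE : s = x |: t.
    by rewrite -sx setDE setUIl [~: t :|: t]setUC setUCr setIT; apply/esym/setUidPl.
  have [l lB' xl] : exists2 l, l \in B & forall y, y \in t -> r l x < r l y.
    move/dominantP: (sC) => /(_ x) [l lB' Hl]; exists l => // y yt.
    rewrite ltn_neqAle Hl ?sE ?inE ?yt ?orbT // andbT.
    by apply/eqP => /r_inj xy; rewrite xy yt in xt.
  have sub l' : (forall y, y \in t -> r l' x < r l' y) -> t \subset [set m i | i in B :\ l'].
    move=> xl'; apply/subsetP => y yt; move/dominantP: (sC) => /(_ y) [i iB Hi].
    have il : i != l'.
      apply/eqP => il; have := Hi x xs; by rewrite leqNgt il xl'.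
    apply/imsetP; exists i; rewrite ?inE ?il //.
    apply: m_eq => // z zt; apply: Hi; exact: (subsetP ts).
  have ljk : (l == j) || (l == k).
    by have [->|->] := rel_jk l lB' (sub l xl); rewrite eqxx ?orbT.
  exists l => //.
  have xQ : x \in Q l.
    apply/QP => i iB il; rewrite ltnNge; apply/negP => xi.
    have xi' y : y \in t -> r i x < r i y.
      move=> yt; rewrite ltn_neqAle (leq_trans xi) ?m_min // andbT.
      by apply/eqP => /r_inj xy; rewrite xy yt in xt.
    (* Otherwise [x] is the minimum for both [j] and [k], and nothing bounds [m j]. *)
    have ijk := rel_jk i iB (sub i xi').
    move/dominantP: sC => /(_ (m j)) [i' i'B Hi'].
    have i'x : ~ (forall y, y \in t -> r i' x < r i' y).
      by move=> /(_ (m j) (mt j)); rewrite ltnNge Hi'.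
    have mi' : m j = m i'.
      by apply: m_eq => // z zt; apply: Hi'; apply: (subsetP ts).
    have := mj_only i' i'B (esym mi').
    have [lj|lk] := orP ljk.
      move: lj => /eqP lj; case: ijk => ijk; first by rewrite ijk lj eqxx in il.
      by case=> i'e; apply: i'x; rewrite i'e -?lj -?ijk.
    move: lk => /eqP lk; case: ijk => ijk; last by rewrite ijk lk eqxx in il.
    by case=> i'e; apply: i'x; rewrite i'e -?lk -?ijk.
  rewrite /rm; case: pickP => [x1 x1Q|/(_ x)]; last by rewrite xQ.
  case: arg_maxnP => //= x2 x2Q x2max; rewrite sE; congr ((_ |: _), _).
  (* Were the new vertex not [r l]-largest in [Q l], the largest point [x2] would exceed some point
     of [s] in each order of [B], against dominance. *)
  apply/eqP; apply/negPn/negP => xx2.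
  have lx : r l x < r l x2.
    rewrite ltn_neqAle x2max // andbT; apply/eqP => /r_inj /eqP.
    by rewrite (negbTE xx2).
  move/dominantP: sC => /(_ x2) [i iB Hi].
  have [il|il] := eqVneq i l.
    by have := Hi x xs; rewrite il leqNgt lx.
  have := Hi (m i) (subsetP ts _ (mt i)).
  by rewrite leqNgt (QP _ _ x2Q).
(* A new vertex common to both sides would lie above [m k] in the order [k], being in [Q j], and
   below it by [Qlt], being in [Q k]. *)
have rm_neq : rm j != rm k.
  apply/eqP; rewrite {1}/rm; case: pickP => [x1 x1Q|Qj0]; rewrite /rm; case: pickP => [x2 x2Q|Qk0].
  - case: arg_maxnP => //= y1 y1Q _; case: arg_maxnP => //= y2 y2Q _ [] yy.
    have y12 : y1 = y2.
      have : y1 \in y2 |: t by rewrite -yy setU11.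
      by rewrite !inE (negbTE (Qnt j y1 _ y1Q)) ?eqxx // orbF => /eqP.
    have := Qlt k y2; rewrite eqxx orbT => /(_ isT y2Q).
    rewrite -y12; move/QP: y1Q => /(_ k kB); rewrite eq_sym => /(_ jk) h1 h2.
    by have := ltn_trans h1 h2; rewrite ltnn.
  - by move=> /(congr1 snd) /= /setP /(_ k); rewrite !inE eqxx kB.
  - by move=> /(congr1 snd) /= /setP /(_ j); rewrite !inE eqxx jB.
  - by move=> /(congr1 snd) /= /setP /(_ k); rewrite !inE eqxx kB eq_sym jk.
suff -> : [set e | is_room e && incident (t, B) e] = [set rm j; rm k].
  by rewrite cards2 rm_neq.
apply/setP => e; rewrite !inE; apply/idP/idP.
  by move=> /andP [h1 h2]; have [->|->] := rm_uniq e h1 h2; rewrite eqxx ?orbT.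
by move=> /orP [] /eqP ->; apply: rm_room; rewrite eqxx ?orbT.
Qed.

Lemma dominantW s C t B : t \subset s -> C \subset B -> dominant s C -> dominant t B.
Proof.
move=> ts CB /dominantP sC; apply/dominantP => x; have [i iC Hi] := sC x.
by exists i => [|y yt]; [exact: (subsetP CB)|apply/Hi/(subsetP ts)].
Qed.

Variables (c : X -> I) (i0 : I).

Definition is_i0_door d := is_door d && ((i0 \in d.2) && (c @: d.1 == d.2 :\ i0)).

Lemma incident_cases t B s C : #|B| = #|t|.+1 -> #|s| = #|C| -> incident (t, B) (s, C) ->
  (exists2 x, x \in s & t = s :\ x /\ B = C) \/
  (exists2 i, i \notin C & t = s /\ B = i |: C).
Proof.
move=> cB cs /andP [/= ts CB].
have := subset_leq_card ts; rewrite leq_eqVlt => /orP [/eqP cts|cts].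
  have st : t = s by apply/eqP; rewrite eqEcard ts cts leqnn.
  right; have : #|B :\: C| == 1 by rewrite cardsD (setIidPr CB) cB -cs cts subSn // subnn.
  move=> /cards1P [l Bl]; have : l \in B :\: C by rewrite Bl set11.
  rewrite inE => /andP [lC lB']; exists l => //; split => //.
  by rewrite -Bl setDE setUIl [~: C :|: C]setUC setUCr setIT; apply/esym/setUidPl.
left.
have cC : #|C| = #|B|.
  by apply/eqP; rewrite eqn_leq subset_leq_card //= cB -cs.
have CBe : C = B by apply/eqP; rewrite eqEcard CB cC leqnn.
have : #|s :\: t| == 1 by rewrite cardsD (setIidPr ts) cs cC cB subSn // subnn.
move=> /cards1P [x sx].
have : x \in s :\: t by rewrite sx set11.
rewrite inE => /andP [xt xs]; exists x => //; split => //.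
by rewrite -sx setDDr setDv set0U (setIidPr ts).
Qed.

(** For [i0] in [C] the colours of [s] decide. If they are those of [C] except [i0], one pair of
    points shares a colour and either may be removed. If one further colour [i], outside [C],
    occurs, the two doors are got by removing the point coloured [i] or by adding the order [i]. In
    the remaining cases, including [i0] outside [C], there is no door. *)
Lemma room_doors_even e : is_room e -> c @: e.1 != e.2 ->
  ~~ odd #|[set d | is_i0_door d && incident d e]|.
Proof.
case: e => s C /andP [/= sC /eqP cs] ncol.
set DD := [set _ | _].
have domx x : dominant (s :\ x) C by apply: dominantW sC; rewrite // subsetDl.
have domi i : dominant s (i |: C) by apply: dominantW sC; rewrite // subsetUr.
have DDP d : reflect
   ((exists2 x, x \in s & [/\ d = (s :\ x, C), i0 \in C & c @: (s :\ x) = C :\ i0]) \/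
    (exists2 i, i \notin C & [/\ d = (s, i |: C), i0 \in i |: C & c @: s = (i |: C) :\ i0]))
   (d \in DD).
  rewrite inE; apply: (iffP idP).
    case: d => t B /andP [/andP [/andP [/= _ /eqP cB] /andP [iB /eqP ct]]] inc.
    have [[x xs [tE BE]]|[i iC [tE BE]]] := incident_cases cB cs inc; subst t B.
      by left; exists x.
    by right; exists i.
  move=> [[x xs [-> iC cx]]|[i iC [-> iC' cx]]]; rewrite /is_i0_door /is_door /incident /=.
    have := cardsD1 x s; rewrite xs cs add1n => <-.
    by rewrite domx iC cx !eqxx subsetDl subxx.
  by rewrite domi iC' cx cs cardsU1 iC add1n !eqxx subxx subsetUr.
have [iC|iC] := boolP (i0 \in C); last first.
  suff -> : DD = set0 by rewrite cards0.
  apply/setP => d; rewrite [RHS]inE; apply/negbTE/negP => /DDP [[x _ []]|[i iC' [_]]].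
    by rewrite (negbTE iC).
  rewrite !inE (negbTE iC) orbF => /eqP <- cE; case/negP: ncol; rewrite cE; apply/eqP.
  by rewrite setU1K.
have cC : #|C| = #|C :\ i0|.+1 by rewrite (cardsD1 i0 C) iC.
have [cE|cN] := eqVneq (c @: s) (C :\ i0).
    have [//|x [y [[xs ys xy _] [cx cy _ only]]]] := @collision _ _ c s; first by rewrite cE -cC.
    suff -> : DD = [set (s :\ x, C); (s :\ y, C)].
      rewrite cards2; suff -> : ((s :\ x, C) != (s :\ y, C)) by [].
      by apply/eqP => /(congr1 fst) /= /setP /(_ x); rewrite !inE eqxx xy xs.
    apply/setP => d; rewrite [RHS]inE; apply/DDP/orP; rewrite !inE.
      move=> [[z zs [-> _ cz]]|[i iC' [_ _ ci]]].
        by have [|->|->] := only z zs; rewrite ?eqxx; [rewrite cE|left|right].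
      have : i \in C :\ i0 by rewrite -cE ci !inE eqxx andbT; apply: contraNneq iC' => ->.
      by rewrite !inE (negbTE iC') andbF.
    by move=> [] /eqP ->; left; [exists x|exists y]; rewrite ?cx ?cy.
have [i /andP [iC' /eqP cE]|no] := pickP [pred i | (i \notin C) && (c @: s == (i |: C) :\ i0)].
  have ii0 : i != i0 by apply: contraNneq iC' => ->.
  have injs : {in s &, injective c}.
    apply/imset_injP; rewrite cE cs cC.
    have -> : (i |: C) :\ i0 = i |: (C :\ i0).
      by apply/setP => z; rewrite !inE; case: (eqVneq z i) => // ->; rewrite ii0.
    by rewrite cardsU1 !inE (negbTE iC') andbF add1n.
  have : i \in c @: s by rewrite cE !inE ii0 eqxx.
  move=> /imsetP [x xs ix].
  suff -> : DD = [set (s :\ x, C); (s, i |: C)].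
    rewrite cards2; suff -> : ((s :\ x, C) != (s, i |: C)) by [].
    by apply/eqP => /(congr1 fst) /= /setP /(_ x); rewrite !inE eqxx xs.
  apply/setP => d; rewrite [RHS]inE; apply/DDP/orP; rewrite !inE.
    move=> [[z zs [-> _ cz]]|[i' iC'' [-> _ ci]]]; [left|right].
      suff -> : z = x by [].
      apply/eqP/negPn/negP => zx.
      have : i \in C :\ i0 by rewrite -cz ix imset_f // !inE eq_sym zx.
      by rewrite !inE (negbTE iC') andbF.
    have : i \in (i' |: C) :\ i0 by rewrite -ci cE !inE ii0 eqxx.
    by rewrite !inE (negbTE iC') orbF => /andP [_ /eqP ->].
  move=> [] /eqP ->; [left; exists x|right; exists i] => //; split => //; last first.
    by rewrite !inE iC orbT.
  apply/setP => z; apply/imsetP/idP.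
    move=> [w]; rewrite !inE => /andP [wx ws] ->.
    have : c w \in c @: s by rewrite imset_f.
    rewrite cE !inE => /andP [-> /orP [/eqP cw|->//]].
    by move: wx; rewrite (injs w x) // ?eqxx // cw.
  rewrite !inE => /andP [zi0 zC].
  have : z \in c @: s by rewrite cE !inE zi0 zC orbT.
  move=> /imsetP [w ws zw]; exists w => //; rewrite !inE ws andbT.
  by apply: contraNneq iC' => wx; rewrite ix -wx -zw.
suff -> : DD = set0 by rewrite cards0.
apply/setP => d; rewrite [RHS]inE; apply/negbTE/negP => /DDP [[x xs [_ _ cx]]|[i iC' [_ _ ci]]].
  have cE : c @: s = c x |: (C :\ i0) by rewrite -cx -imsetU1 setD1K.
  have [xC|xC] := boolP (c x \in C); last first.
    have := no (c x); rewrite /= xC cE /= => /eqP; apply; apply/setP => z; rewrite !inE.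
    by case: (eqVneq z (c x)) => //= ->; rewrite andbT; apply/esym; apply: contraNneq xC => ->.
  have [xi|xi] := eqVneq (c x) i0.
    by case/negP: ncol; rewrite cE xi setD1K.
  case/negP: cN; rewrite cE; apply/eqP/setUidPr.
  by rewrite sub1set !inE xi xC.
by have := no i; rewrite /= iC' ci eqxx.
Qed.

(* Count modulo 2 the incidences between rooms and doors of colours [B :\ i0]: the
   doors have two rooms except the outer door [(set0, [set i0])], which has one. *)
Theorem scarf (x0 : X) : exists s C, dominant s C /\ c @: s = C.
Proof.
have [/existsP [[s C] /andP [/andP [sC _] /eqP cs]]|/existsPn no] :=
  boolP [exists e, is_room e && (c @: e.1 == e.2)]; first by exists s, C.
exfalso.
pose n := \sum_(d | is_i0_door d) \sum_(e | is_room e && incident d e) 1.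
have nE : n = \sum_(e | is_room e) \sum_(d | is_i0_door d && incident d e) 1.
  rewrite /n (exchange_big_dep is_room) => /= [|d e _ /andP [] //].
  by apply: eq_bigr => e re; apply: eq_bigl => d; rewrite re.
have : ~~ odd n.
  rewrite nE; elim/big_ind: _ => //= [p q hp hq|e re].
    by rewrite oddD (negbTE hp) (negbTE hq).
  rewrite sum1dep_card; apply: room_doors_even => //.
  by have := no e; rewrite re.
suff -> : odd n by [].
have D0 : is_i0_door (set0, [set i0]).
  rewrite /is_i0_door /is_door /= cards1 cards0 inE !eqxx andbT imset0 setDv eqxx andbT /=.
  by rewrite andbT; apply/dominantP => x; exists i0; rewrite ?inE // => y; rewrite inE.
rewrite /n (bigD1 _ D0) /= oddD.
have -> : odd (\sum_(i | is_i0_door i && (i != (set0, [set i0])))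
   \sum_(e | is_room e && incident i e) 1) = false.
  apply/negbTE; elim/big_ind: _ => //= [p q hp hq|[t B] /andP [di dn]].
    by rewrite oddD (negbTE hp) (negbTE hq).
  rewrite sum1dep_card; case/andP: di => dB /andP [/= iB /eqP ct].
  rewrite door_rooms //; apply: contraNneq dn => t0.
  rewrite t0 xpair_eqE eqxx /=; move: ct; rewrite t0 imset0 => /esym/eqP.
  by rewrite setD_eq0 subset1 => /orP [//|/eqP B0]; rewrite B0 inE in iB.
rewrite addbF sum1dep_card.
pose x1 := [arg max_(x > x0) r i0 x].
suff -> : [set e | is_room e && incident (set0, [set i0]) e] = [set ([set x1], [set i0])].
  by rewrite cards1.
have x1max x : r i0 x <= r i0 x1 by rewrite /x1; case: arg_maxnP => // y _ H; exact: H.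
apply/setP => -[s C]; rewrite !inE; apply/idP/idP.
  move=> /andP [/andP [/= sC /eqP cs] /andP [/= _]].
  rewrite subset1 => /orP [] /eqP CE; subst C; last first.
    by move/dominantP: sC => /(_ x0) [i]; rewrite inE.
  move: cs; rewrite cards1 => /eqP /cards1P [x sx]; subst s.
  rewrite xpair_eqE eqxx andbT; apply/eqP; congr [set _].
  move/dominantP: sC => /(_ x1) [i]; rewrite inE => /eqP -> /(_ x); rewrite inE eqxx => /(_ isT) h.
  by apply: (r_inj (i := i0)); apply/eqP; rewrite eqn_leq x1max h.
move=> /eqP [-> ->]; rewrite /is_room /incident /= !cards1 sub0set subxx !andbT.
by apply/dominantP => x; exists i0; rewrite ?inE // => y; rewrite inE => /eqP ->.
Qed.

End Scarf.

(* The lattice points of the simplex with denominator [N], with the coordinates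
   (ties being broken arbitrarily) as the orders of [scarf]. *)
Lemma scarf_simplex (I : finType) (i0 : I) (N : nat) (col : {ffun I -> 'I_N.+1} -> I) :
  exists (x : {ffun I -> 'I_N.+1}),
  \sum_i x i = N /\
  forall i, 0 < x i -> exists y : {ffun I -> 'I_N.+1},
    [/\ \sum_i y i = N, col y = i &
     forall j, x j <= y j + #|I| * #|I|.+1 /\ y j <= x j + #|I| * #|I|.+1].
Proof.
pose X : finType := {x : {ffun I -> 'I_N.+1} | \sum_i x i == N}.
pose r (i : I) (x : X) := (val x i * #|X| + enum_rank x)%N.
have r_inj i : injective (r i).
  move=> x y /(congr1 (modn^~ #|X|)); rewrite /r !modnMDl !modn_small ?ltn_ord //.
  by move=> /ord_inj /enum_rank_inj.
have r_le i x y : r i x <= r i y -> val x i <= val y i.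
  rewrite /r; apply: contraTT; rewrite -!ltnNge => xy.
  have := ltn_ord (enum_rank y); rewrite -[T in _ < T -> _]/#|X|; nia.
have mkX (z : I -> nat) : \sum_i z i = N -> exists x : X, forall i, val x i = z i :> nat.
  move=> zN; have zle i : z i < N.+1 by rewrite ltnS -zN (bigD1 i) //= leq_addr.
  pose f := [ffun i => Ordinal (zle i)].
  have xP : \sum_i f i == N.
    by rewrite -[X in _ == X]zN; apply/eqP/eq_bigr => i _; rewrite ffunE.
  by exists (Sub f xP) => i; rewrite SubK ffunE.
pose w (x : X) j : nat := val x j.
have [x0 _] : exists x : X, forall i, val x i = (if i == i0 then N else 0) :> nat.
  apply: (mkX (fun i => if i == i0 then N else 0)).
  by rewrite -big_mkcond /= big_pred1_eq.
have [s [C [/dominantP sC cs]]] := scarf r_inj (fun x => col (val x)) i0 x0.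
have [i1 i1C _] := sC x0.
have [x1 x1s] : exists x, x \in s.
  by move: i1C; rewrite -cs => /imsetP [x xs _]; exists x.
pose m i := val [arg min_(x < x1 in s) (val x i : nat)] i : nat.
have mle i x : x \in s -> m i <= val x i.
  by rewrite /m; case: arg_minnP => // y _ + xs; apply.
have mE i : exists2 x, x \in s & m i = val x i.
  by rewrite /m; case: arg_minnP => // y ys _; exists y.
(* Otherwise some lattice point would exceed [m i] in every coordinate [i] of [C], against
   dominance; what is left of [N] is put on [i1]. *)
have mN : N < \sum_(i in C) (m i).+1.
  rewrite ltnNge; apply/negP => leN.
  pose z i := (if i \in C then (m i).+1 else 0) +
    (if i == i1 then N - \sum_(i in C) (m i).+1 else 0).
  have [|y yz] := mkX z.
    rewrite big_split /= -!big_mkcond /= big_pred1_eq; lia.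
  have [i iC Hi] := sC y; have [x xs mx] := mE i.
  have := r_le _ _ _ (Hi x xs); rewrite yz /z iC -mx; lia.
have sumC : \sum_(i in C) (m i).+1 = \sum_(i in C) m i + #|C|.
  by under eq_bigr do rewrite -addn1; rewrite big_split /= sum1_card.
rewrite {}sumC in mN.
have cC : #|C| <= #|I| by apply: max_card.
have xN (x : X) : \sum_i (val x i : nat) = N by case: x => x xP; apply/eqP; exact: xP.
have {xN} xN (x : X) : \sum_(i in C) w x i + \sum_(i | i \notin C) w x i = N.
  by apply: etrans (xN x); rewrite [RHS](bigID (mem C)).
have {}mle i x : x \in s -> m i <= w x i by exact: mle.
(* The coordinates of a point of [s] sum to [N], which exceeds the sum of the minima over [C] by
   less than [#|C|]. This bounds the coordinates outside [C] and the deviations from the minima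
   inside. *)
have smallC i x : x \in s -> i \notin C -> w x i < #|I|.
  move=> xs iC; have := xN x; rewrite [X in _ + X](bigD1 i iC).
  have : \sum_(i in C) m i <= \sum_(i in C) w x i by apply: leq_sum => j _; apply: mle.
  by move: mN cC => /=; move: (w x i) => wxi; lia.
have bigC i x : x \in s -> i \in C -> w x i < m i + #|I|.
  move=> xs iC; have := xN x.
  have E1 : \sum_(j in C) m j = m i + \sum_(j in C | j != i) m j by exact: (bigD1 i iC).
  have E2 : \sum_(j in C) w x j = w x i + \sum_(j in C | j != i) w x j.
    exact: (bigD1 i iC).
  have : \sum_(j in C | j != i) m j <= \sum_(j in C | j != i) w x j.
    by apply: leq_sum => j /andP [_ _]; apply: mle.
  by move: mN; rewrite E1 E2; lia.
have close x y j : x \in s -> y \in s -> w x j <= w y j + #|I|.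
  move=> xs ys; have [jC|jC] := boolP (j \in C).
    by have := bigC j x xs jC; have := mle j y ys; lia.
  by have := smallC j x xs jC; lia.
(* Moving the coordinates of [x1] outside [C] to [i1] confines the support to [C], all of whose
   elements are colours of points of [s]. The move costs at most [#|I| * #|I|], and points of [s]
   differ by at most [#|I|] in a coordinate, hence the constant. *)
pose rest := \sum_(i | i \notin C) w x1 i.
have restI : rest <= #|I| * #|I|.
  apply: leq_trans (_ : \sum_(i | i \notin C) #|I| <= _).
    by apply: leq_sum => i iC; apply: ltnW; exact: smallC.
  by rewrite sum_nat_const leq_mul2r max_card orbT.
pose z i := (if i \in C then w x1 i else 0) + (if i == i1 then rest else 0).
have [|x xz] := mkX z.
  by rewrite big_split /= -!big_mkcond /= big_pred1_eq; exact: xN.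
exists (val x); split=> [|i].
  by case: (x) => u uP; apply/eqP; exact: uP.
rewrite xz /z; have [iC _|iC] := boolP (i \in C); last first.
  by case: eqP iC => [->|//]; rewrite i1C.
move: iC; rewrite -{1}cs => /imsetP [y ys ->]; exists (val y); split => // [|j].
  by case: (y) => u uP; apply/eqP; exact: uP.
rewrite xz /z mulnS -/(w y j).
have := close x1 y j x1s ys; have := close y x1 j ys x1s.
have [jC|jC] := boolP (j \in C); last first.
  have := smallC j y ys jC; case: eqP jC => [->|_ _]; first by rewrite i1C.
  by lia.
by case: (j == i1); lia.
Qed.

From mathcomp Require Import all_order all_algebra.
From mathcomp Require Import all_classical all_reals all_analysis.
From mathcomp Require Import ring lra.

Import Order.TTheory GRing.Theory Num.Theory.
Import numFieldTopology.Exports numFieldNormedType.Exports.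

Local Open Scope classical_set_scope.
Local Open Scope ring_scope.

(** * The Hahn-Banach theorem *)

(** A predicate on bare functions, because forms arise below as minimal sublinear functions and as
    pointwise limits. *)
Definition linear_form (R : realType) (V : lmodType R) (f : V -> R) :=
  forall a x y, f (a *: x + y) = a * f x + f y.

Section LinearForm.
Variables (R : realType) (V : lmodType R) (f : V -> R).
Hypothesis fl : linear_form f.

Lemma linear_form0 : f 0 = 0.
Proof. by have := fl 1 0 0; rewrite scale1r addr0 mul1r; lra. Qed.

Lemma linear_formD x y : f (x + y) = f x + f y.
Proof. by have := fl 1 x y; rewrite scale1r mul1r. Qed.

Lemma linear_formZ a x : f (a *: x) = a * f x.
Proof. by have := fl a x 0; rewrite !addr0 linear_form0 addr0. Qed.

Lemma linear_formN x : f (- x) = - f x.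
Proof. by rewrite -scaleN1r linear_formZ mulN1r. Qed.

Lemma linear_formB x y : f (x - y) = f x - f y.
Proof. by rewrite linear_formD linear_formN. Qed.

End LinearForm.

Section HahnBanach.
Variables (R : realType) (V : lmodType R).
Implicit Types p q : V -> R.

(** An inequality suffices for homogeneity: applied to the inverse scalar it yields the equation
    [sublinearZ]. *)
Definition sublinear p := (forall x y, p (x + y) <= p x + p y) /\
  (forall a x, 0 <= a -> p (a *: x) <= a * p x).

Lemma sublinear0 p : sublinear p -> p 0 = 0.
Proof.
move=> [pD pZ]; apply/eqP; rewrite eq_le; apply/andP; split.
  by have := pZ 0 0 (lexx _); rewrite scaler0 mul0r.
by have := pD 0 0; rewrite addr0; lra.
Qed.

Lemma sublinearZ p a x : sublinear p -> 0 <= a -> p (a *: x) = a * p x.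
Proof.
move=> ps; rewrite le_eqVlt => /predU1P [<-|a0].
  by rewrite scale0r mul0r sublinear0.
apply/eqP; rewrite eq_le ps.2 ?(ltW a0) //=.
rewrite -ler_pdivlMl // -{1}[x](scalerK (lt0r_neq0 a0)).
by apply: ps.2; rewrite invr_ge0 ltW.
Qed.

Lemma sublinear_ge p x : sublinear p -> - p (- x) <= p x.
Proof. by move=> ps; have := ps.1 x (- x); rewrite subrr sublinear0 //; lra. Qed.

Lemma inf_le_image (I : Type) (D : set I) (g : I -> R) m i :
  (forall j, D j -> m <= g j) -> D i -> inf [set g j | j in D] <= g i.
Proof.
move=> mg Di; apply: ge_inf; last by exists i.
by exists m => _ [j Dj <-]; exact: mg.
Qed.

Lemma inf_ge_image (I : Type) (D : set I) (g : I -> R) m :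
  D !=set0 -> (forall j, D j -> m <= g j) -> m <= inf [set g j | j in D].
Proof.
move=> [i Di] mg; apply: lb_le_inf; first by exists (g i), i.
by move=> _ [j Dj <-]; exact: mg.
Qed.

(** Three infima below have this shape: that of a chain of sublinear functions, that which proves a
    minimal one additive, and that which separates a convex set from 0. The bound [l] keeps them
    finite. *)
Lemma inf_sublinear (I : Type) (D : set I) (G : I -> V -> R) (l : V -> R) :
  D !=set0 -> (forall i x, D i -> l x <= G i x) ->
  (forall i j x y, D i -> D j -> exists2 k, D k & G k (x + y) <= G i x + G j y) ->
  (forall i a x, D i -> 0 <= a -> exists2 k, D k & G k (a *: x) <= a * G i x) ->
  sublinear (fun x => inf [set G i x | i in D]).
Proof.
move=> D0 Gl GD GZ; have infle x i : D i -> inf [set G i x | i in D] <= G i x.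
  by move=> Di; apply: (@inf_le_image _ D (G^~ x) (l x)) => // j; exact: Gl.
split=> [x y|a x a0].
  rewrite /= -lerBlDr; apply: inf_ge_image => // i Di.
  rewrite lerBlDr -lerBlDl; apply: inf_ge_image => // j Dj.
  have [k Dk Gk] := GD i j x y Di Dj.
  by rewrite lerBlDl; apply: le_trans Gk; exact: infle.
have infa i : D i -> inf [set G i (a *: x) | i in D] <= a * G i x.
  by move=> Di; have [k Dk Gk] := GZ i a x Di a0; apply: le_trans Gk; exact: infle.
move: a0; rewrite le_eqVlt => /predU1P [a0|a0].
  by have [i Di] := D0; have := infa i Di; rewrite -a0 !mul0r.
by rewrite -ler_pdivrMl //; apply: inf_ge_image => // i Di; rewrite ler_pdivrMl // infa.
Qed.

(* A minimal sublinear function is linear. *)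
Theorem sublinear_dominates_linear p : sublinear p ->
  exists2 f, linear_form f & forall x, f x <= p x.
Proof.
move=> ps.
pose T := {q | sublinear q /\ forall x, q x <= p x}.
(* The order is reversed, so that the maximal element of Zorn's lemma is a minimal sublinear
   function. *)
pose rel (q1 q2 : T) := `[< forall x, sval q2 x <= sval q1 x >].
have [||A Atot|q qmin] := @ZL_preorder T (exist _ p (conj ps (fun x => lexx (p x)))) rel.
- by move=> q; apply/asboolP.
- by move=> q1 q2 q3 /asboolP h1 /asboolP h2; apply/asboolP => x; exact: le_trans (h1 x).
- have [A0|/set0P A0] := eqVneq A set0.
    by exists (exist _ p (conj ps (fun x => lexx (p x)))); rewrite A0.
  pose q x := inf [set sval i x | i in A].
  have lA (i : T) x : A i -> - p (- x) <= sval i x.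
    move=> _; apply: le_trans (sublinear_ge x (svalP i).1).
    by rewrite lerN2; exact: (svalP i).2.
  have qs : sublinear q.
    apply: (inf_sublinear (l := fun x => - p (- x))) => //.
      move=> i j x y Ai Aj; have [/asboolP ij|/asboolP ji] := Atot i j Ai Aj.
        exists j => //; apply: le_trans ((svalP j).1.1 x y) _.
        by rewrite lerD2r; exact: ij.
      exists i => //; apply: le_trans ((svalP i).1.1 x y) _.
      by rewrite lerD2l; exact: ji.
    by move=> i a x Ai a0; exists i => //; exact: (svalP i).1.2.
  have qle (i : T) x : A i -> q x <= sval i x.
    by move=> Ai; apply: (@inf_le_image _ A (fun i : T => sval i x) (- p (- x))) => // j; exact: lA.
  have qp x : q x <= p x.
    have [i Ai] := A0; apply: le_trans (qle i x Ai) _; exact: (svalP i).2.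
  by exists (exist _ q (conj qs qp)) => i Ai; apply/asboolP => x; exact: qle.
case: q qmin => q [qs qp] /= qmin; exists q => //.
have qmin' q' : sublinear q' -> (forall x, q' x <= q x) -> forall x, q x <= q' x.
  move=> q's q'q; have q'p x : q' x <= p x by exact: le_trans (q'q x) (qp x).
  by have := qmin (exist _ q' (conj q's q'p)); move=> /(_ _) /asboolP; apply; apply/asboolP.
have qD x y : q (x + y) = q x + q y.
  apply/eqP; rewrite eq_le qs.1 /=.
  (* [q'] is sublinear and below [q], hence equal to it by minimality; the term [t = 1] of the
     infimum then gives [q x <= q (x + y) - q y]. *)
  pose G t x := q (x + t *: y) - t * q y.
  pose q' x := inf [set G t x | t in [set t | 0 <= t]].
  have Gl t z : 0 <= t -> - q (- z) <= G t z.
    move=> t0; rewrite /G; have := qs.1 (z + t *: y) (- z).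
    by rewrite addrAC subrr add0r sublinearZ //; lra.
  have q's : sublinear q'.
    apply: (inf_sublinear (l := fun z => - q (- z))) => //; first by exists 0 => /=.
      move=> s t z w s0 t0; exists (s + t); first exact: addr_ge0.
      rewrite /G scalerDl addrACA mulrDl.
      have := qs.1 (z + s *: y) (w + t *: y); lra.
    move=> t a z t0 a0; exists (a * t); first exact: mulr_ge0.
    by rewrite /G -scalerA -scalerDr sublinearZ // mulrBr mulrA.
  have q'le t z : 0 <= t -> q' z <= G t z.
    move=> t0; apply: (@inf_le_image _ [set t | 0 <= t] (G^~ z) (- q (- z))) => // s; exact: Gl.
  have q'q z : q' z <= q z.
    by apply: le_trans (q'le 0 z (lexx _)) _; rewrite /G scale0r addr0 mul0r subr0.
  have := le_trans (qmin' q' q's q'q x) (q'le 1 x ler01).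
  by rewrite /G scale1r mul1r lerBrDr.
have qN x : q (- x) = - q x.
  by have := qD x (- x); rewrite subrr sublinear0 //; lra.
move=> a x y; rewrite qD; congr (_ + _).
have [a0|a0] := leP 0 a; first exact: sublinearZ.
by rewrite -[a]opprK scaleNr qN sublinearZ ?oppr_ge0 ?(ltW a0) // [RHS]mulNr.
Qed.

End HahnBanach.

(** * Bounded forms and separation of convex sets *)

Section NormedDual.
Variables (R : realType) (E : normedModType R).
Implicit Types (f g : E -> R) (k : R).

Definition bounded_form k f := linear_form f /\ forall x, `|f x| <= k * `|x|.

Lemma is_convexP (M : set E) : is_convex M <->
  forall x y s, M x -> M y -> 0 <= s -> s <= 1 -> M (s *: x + (1 - s) *: y).
Proof.
split=> [cM x y s Mx My s0 s1|cM x y l /set_mem Mx /set_mem My].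
  have s01 : Itv.spec (@Itv.num_sem R) (Itv.Real `[0%Z, 1%Z]) s.
    by rewrite /Itv.spec /Itv.num_sem /= in_itv /= s0 s1 ger0_real.
  have := cM x y (Itv.mk s01) (mem_set Mx) (mem_set My).
  by move=> /set_mem.
apply/mem_set; have := cM x y l%:num Mx My; apply.
  exact: ge0.
exact: le1.
Qed.

(* A linear form below [p h = inf_(t >= 0, z in Z) (|h + t z| - t rho)] has norm
   at most 1 (take [t = 0]) and is at least [rho] on [Z] (take [h = - z], [t = 1]). *)
Theorem convex_away_from_0 (Z : set E) rho : is_convex Z ->
  Z !=set0 -> (forall z, Z z -> rho <= `|z|) ->
  exists2 f, bounded_form 1 f & forall z, Z z -> rho <= f z.
Proof.
move=> /is_convexP cZ [z0 Zz0] Zr.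
pose D := [set tz : R * E | 0 <= tz.1 /\ Z tz.2].
pose G (tz : R * E) h := `|h + tz.1 *: tz.2| - tz.1 * rho.
pose p h := inf [set G tz h | tz in D].
have Gl tz h : D tz -> - `|h| <= G tz h.
  move=> [t0 Zz]; rewrite /G.
  have h1 : tz.1 * rho <= `|tz.1 *: tz.2| by rewrite normrZ ger0_norm // ler_wpM2l // Zr.
  have := ler_normB (h + tz.1 *: tz.2) h; rewrite addrAC subrr add0r; lra.
have ps : sublinear p.
  apply: (inf_sublinear (l := fun h => - `|h|)) => //.
  - by exists (0, z0); split=> /=.
  - move=> [t z] [t' z'] h h' [/= t0 Zz] [/= t'0 Zz'].
    have [tt0|tt0] := eqVneq (t + t') 0.
      exists (0, z); first by split => /=.
      have [-> ->] : t = 0 /\ t' = 0 by split; lra.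
      by rewrite /G /= !scale0r !addr0 !mul0r !subr0; exact: ler_normD.
    have ttgt0 : 0 < t + t' by rewrite lt_neqAle eq_sym tt0 addr_ge0.
    exists (t + t', (t / (t + t')) *: z + (1 - t / (t + t')) *: z').
      split => /=; first exact: addr_ge0.
      apply: cZ => //; first by rewrite divr_ge0 // ltW.
      by rewrite ler_pdivrMr // mul1r lerDl.
    rewrite /G /= scalerDr !scalerA.
    have -> : (t + t') * (t / (t + t')) = t by field.
    have -> : (t + t') * (1 - t / (t + t')) = t' by field.
    by have := ler_normD (h + t *: z) (h' + t' *: z'); rewrite addrACA; lra.
  - move=> [t z] a h [/= t0 Zz] a0; exists (a * t, z); first by split => //=; exact: mulr_ge0.
    by rewrite /G /= -scalerA -scalerDr normrZ ger0_norm // mulrBr mulrA.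
have ple tz h : D tz -> p h <= G tz h.
  by move=> Dtz; apply: (@inf_le_image _ _ D (G^~ h) (- `|h|)) => // j; exact: Gl.
have pn h : p h <= `|h|.
  by apply: le_trans (ple (0, z0) h _) _ => //; rewrite /G /= scale0r addr0 mul0r subr0.
have [f fl fp] := sublinear_dominates_linear ps; exists f.
  split=> // x; rewrite mul1r ler_norml; apply/andP; split.
    by rewrite lerNl -linear_formN //; apply: le_trans (fp _) _; rewrite -[`|x|]normrN.
  exact: le_trans (fp _) _.
move=> z Zz; have := fp (- z); rewrite linear_formN //.
have : p (- z) <= G (1, z) (- z) by apply: ple; split => /=.
by rewrite /G /= scale1r addNr normr0 mul1r; lra.
Qed.

Lemma norming_form (x : E) : exists2 f, bounded_form 1 f & f x = `|x|.
Proof.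
have [||_ ->|f fb fx] := @convex_away_from_0 [set x] `|x|; last 1 first.
- exists f => //; apply/eqP; rewrite eq_le fx // andbT.
  by have := fb.2 x; rewrite mul1r => /(le_trans (ler_norm _)).
- apply/is_convexP => _ _ s -> -> _ _; rewrite /= -scalerDl.
  by rewrite addrC subrK scale1r.
- by exists x.
- by [].
Qed.

(** A ball of radius [e] about [x] misses [Z], so the translate of [Z] by [- x] stays at distance
    [e] from 0; the same [e] is the gap. *)
Theorem separation (Z : set E) x : is_convex Z -> closed Z -> ~ Z x ->
  exists2 f, bounded_form 1 f &
    exists2 d, 0 < d & forall z, Z z -> f x + d <= f z.
Proof.
move=> cZ clZ nZx; have [->|/set0P [z0 Zz0]] := eqVneq Z set0.
  by have [f fb _] := norming_form 0; exists f => //; exists 1.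
have : nbhs x (~` Z) by apply: open_nbhs_nbhs; split => //; exact: closed_openC.
move=> /nbhs_ballP [e /= e0 xe].
have [|||f fb fZ] := @convex_away_from_0 [set z - x | z in Z] e.
- apply/is_convexP => _ _ s [y Zy <-] [z Zz <-] s0 s1.
  exists (s *: y + (1 - s) *: z); first by move/is_convexP: cZ; apply.
  by rewrite !scalerBr addrACA -opprD -scalerDl addrCA subrr addr0 scale1r.
- by exists (z0 - x), z0.
- move=> _ [z Zz <-]; rewrite leNgt; apply/negP => zx.
  by apply: (xe z) => //; rewrite -ball_normE /ball_ /= distrC.
- exists f => //; exists e => // z Zz; have := fZ (z - x) (ex_intro2 _ _ z Zz erefl).
  by rewrite (linear_formB fb.1); lra.
Qed.

End NormedDual.

(** * Weak convergence along filters *)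

Section RealLimits.
Variables (R : realType) (T : Type) (U : set_system T).

Lemma le_of_cvg (h : T -> R) (l m : R) : ProperFilter U ->
  h @ U --> l -> U [set t | h t <= m] -> l <= m.
Proof.
move=> PU hl hm; rewrite leNgt; apply/negP => ml.
have /cvgrPdist_lt /(_ (l - m)) := hl; rewrite subr_gt0 => /(_ ml) hlm.
have [t /= [h1 h2]] := filter_ex (filterI hlm hm).
by move: h1; rewrite distrC ltr_norml => /andP [h1 _]; lra.
Qed.

Lemma ge_of_cvg (h : T -> R) (l m : R) : ProperFilter U ->
  h @ U --> l -> U [set t | m <= h t] -> m <= l.
Proof.
move=> PU hl hm; rewrite -lerN2; apply: (@le_of_cvg (\- h)) => //.
  exact: cvgN.
by apply: filterS hm => t /=; rewrite lerN2.
Qed.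

Lemma cvg_norm_le (h : T -> R) (l m : R) : ProperFilter U ->
  h @ U --> l -> U [set t | `|h t| <= m] -> `|l| <= m.
Proof.
move=> PU hl hm; rewrite ler_norml; apply/andP; split.
  by apply: (ge_of_cvg PU hl); apply: filterS hm => t /=; rewrite ler_norml => /andP [].
by apply: (le_of_cvg PU hl); apply: filterS hm => t /=; rewrite ler_norml => /andP [].
Qed.

Lemma cvgR_unique (h : T -> R) (l l' : R) : ProperFilter U ->
  h @ U --> l -> h @ U --> l' -> l = l'.
Proof.
move=> PU hl hl'; exact: (cvg_unique (@norm_hausdorff _ R) hl hl').
Qed.

Lemma ultra_fmap (T' : Type) (g : T -> T') : UltraFilter U -> UltraFilter (g @ U).
Proof.
move=> UU; split; first exact: fmap_proper_filter.
move=> G GG UG; apply/seteqP; split; last exact: UG.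
move=> A GA; have [//|UnA] := @in_ultra_setVsetC _ U (g @^-1` A) UU.
have GnA : G (~` A) by apply: UG; exact: UnA.
by have [x []] := filter_ex (filterI GA GnA).
Qed.

Lemma ultra_bounded_cvg (h : T -> R) (m : R) : UltraFilter U ->
  U [set t | `|h t| <= m] -> exists l : R, h @ U --> l.
Proof.
move=> UU hm; have := @segment_compact R (- m) m.
rewrite compact_ultra => /(_ (h @ U) (ultra_fmap h UU)).
case; last by move=> l [_ hl]; exists l.
by apply: (@filterS T U _ _ _ _ hm) => t /=; rewrite in_itv /= -ler_norml.
Qed.

End RealLimits.

Section BoundedForms.
Variables (R : realType) (E : normedModType R).
Implicit Types (f g : E -> R) (k : R).

Lemma bounded_formZ k a f : bounded_form k f -> bounded_form (`|a| * k) (fun x => a * f x).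
Proof.
move=> [fl fb]; split=> [b x y|x]; first by rewrite fl; ring.
by rewrite normrM -mulrA ler_wpM2l.
Qed.

Lemma bounded_formD k l f g : bounded_form k f -> bounded_form l g ->
  bounded_form (k + l) (fun x => f x + g x).
Proof.
move=> [fl fb] [gl gb]; split=> [b x y|x]; first by rewrite fl gl; ring.
by rewrite mulrDl (le_trans (ler_normD _ _)) // lerD.
Qed.

Lemma bounded_form1 k f : bounded_form k f -> bounded_form (Num.max k 1) f.
Proof.
by move=> [fl fb]; split => // x; apply: le_trans (fb x) _; rewrite ler_wpM2r // le_max lexx.
Qed.

Lemma bounded_form_dist k f x y : bounded_form k f -> `|f x - f y| <= k * `|x - y|.
Proof. by move=> [fl fb]; rewrite -linear_formB. Qed.

Definition form_of (f : E -> R) (fl : linear_form f) : {linear E -> R^o} :=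
  HB.pack (f : E -> R^o) (GRing.isLinear.Build R E R^o *:%R f fl).

Lemma continuous_form k f (fb : bounded_form k f) : continuous (form_of fb.1).
Proof.
apply: bounded_linear_continuous; apply/linear_boundedP.
exists k; split; first exact: num_real.
move=> r kr x; apply: le_trans (fb.2 x) _.
by rewrite ler_wpM2r // ltW.
Qed.

Arguments continuous_form {k f} fb.

Lemma form_continuous (f : {linear E -> R^o}) : continuous f -> exists k, bounded_form k f.
Proof.
move=> cf; have /linear_boundedP [k [_ H]] := continuous_linear_bounded 0 (cf 0).
exists (k + 1); split=> [a x y|x]; first by rewrite linearP.
by apply: H; rewrite ltrDl.
Qed.

(** Bound 1 suffices by scaling, see [wcvg_form]. An arbitrary filter lets sequences and
    ultrafilters share one notion. *)
Definition wcvg (T : Type) (U : set_system T) (g : T -> E) (y : E) :=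
  forall f, bounded_form 1 f -> f (g t) @[t --> U] --> f y.

Lemma wcvg_form (T : Type) (U : set_system T) (g : T -> E) (y : E) k f :
  Filter U -> wcvg U g y -> bounded_form k f -> f (g t) @[t --> U] --> f y.
Proof.
move=> FU gy /bounded_form1; set k' := Num.max k 1 => fb.
have k'0 : 0 < k' by rewrite lt_max ltr01 orbT.
have fb' : bounded_form 1 (fun x => k'^-1 * f x).
  by have := bounded_formZ k'^-1 fb; rewrite gtr0_norm ?invr_gt0 // mulVf // gt_eqF.
have E1 x : f x = k' * (k'^-1 * f x) by rewrite mulrA divff ?gt_eqF // mul1r.
rewrite (E1 y) (_ : (fun t => f (g t)) = (fun t => k' * (k'^-1 * f (g t)))); last first.
  by apply/funext => t; rewrite -E1.
exact: (@cvgMl_tmp R T U _ _ k' _ (gy _ fb')).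
Qed.

Lemma weakly_cvgE (u : nat -> E) x : weakly_cvg u x <-> wcvg \oo u x.
Proof.
split=> [/weakly_cvgP H f fb|H].
  exact: (H (form_of fb.1) (continuous_form fb)).
apply/weakly_cvgP => f /form_continuous [k fb].
exact: (wcvg_form _ H fb).
Qed.

Lemma cvg_weakE (F : set_system E) (x : E) : Filter F ->
  (F : set_system (weak E)) --> (x : weak E) <-> wcvg F id x.
Proof.
move=> FF; split=> [/cvg_sup Fx f fb|Fx].
  move=> B /= /(@initial_continuous E R^o (form_of fb.1) x) fB.
  exact: (Fx (exist _ (form_of fb.1) (continuous_form fb)) _ fB).
apply/cvg_sup => -[f cf] B [_ [[C Cop <-] Cfx] CB].
have [k fb] := form_continuous cf.
have /(wcvg_form _ Fx fb) fC : nbhs (f x : R^o) C by apply: open_nbhs_nbhs; split.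
by apply: (@filterS _ F _ _ _ _ fC) => n /= ?; exact: CB.
Qed.

Lemma wcvg_closed_convex (T : Type) (U : set_system T) (g : T -> E) (y : E) (Z : set E) :
  ProperFilter U -> closed Z -> is_convex Z -> U [set t | Z (g t)] -> wcvg U g y -> Z y.
Proof.
move=> PU clZ cZ gZ gy; apply: contrapT => nZy.
have [f fb [d d0 fd]] := separation cZ clZ nZy.
have : f y + d <= f y.
  by apply: (ge_of_cvg PU (gy f fb)); apply: filterS gZ => t /=; exact: fd.
by rewrite gerDl leNgt d0.
Qed.

(** The limit may lie outside [X], so the property passes to subsets and no weak closure has to be
    formed. *)
Definition rel_weakly_compact (X : set E) :=
  forall U : set_system E, UltraFilter U -> U X -> exists y, wcvg U id y.

Lemma rel_weakly_compact_wcvg (T : Type) (U : set_system T) (g : T -> E) X :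
  UltraFilter U -> rel_weakly_compact X -> U [set t | X (g t)] -> exists y, wcvg U g y.
Proof. by move=> UU Xc gX; exact: (Xc (g @ U) (ultra_fmap g UU)). Qed.

Lemma weakly_compact_rel (K : set E) : weakly_compact K -> rel_weakly_compact K.
Proof.
rewrite /weakly_compact compact_ultra => Kc U UU UK.
have [y [_ Uy]] := Kc U UU UK; exists y; exact/cvg_weakE.
Qed.

Lemma rel_weakly_compact_closed (K : set E) : closed K -> is_convex K ->
  rel_weakly_compact K -> weakly_compact K.
Proof.
move=> clK cK Kc; rewrite /weakly_compact compact_ultra => U UU UK.
have [y Uy] := Kc U UU UK; exists y; split; last exact/cvg_weakE.
exact: (wcvg_closed_convex _ clK cK UK Uy).
Qed.

(* [n <= e n] is all that is needed of a subsequence here, and it is stable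
   under composition. *)
Definition subseq_wcvg (x : nat -> E) :=
  exists2 e : nat -> nat, (forall n, (n <= e n)%N) &
  exists y, wcvg \oo (x \o e) y.

End BoundedForms.

Section Complete.
Variables (R : realType) (E : completeNormedModType R).

(* Completeness of [E] shows that the canonical image of [E] is closed in its bidual. *)
Lemma approx_evaluation (Lam : (E -> R) -> R) :
  (forall e, 0 < e -> exists y, forall f, bounded_form 1 f -> `|Lam f - f y| <= e) ->
  exists y, forall f, bounded_form 1 f -> Lam f = f y.
Proof.
move=> H.
have {H} /choice [y yP] : forall n : nat, exists y, forall f : E -> R, bounded_form 1 f ->
    `|Lam f - f y| <= n.+1%:R^-1 by move=> n; apply: H; rewrite invr_gt0 ltr0n.
have ydist m n : `|y m - y n| <= m.+1%:R^-1 + n.+1%:R^-1.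
  have [f fb <-] := norming_form (y m - y n); rewrite (linear_formB fb.1).
  have := yP m f fb; have := yP n f fb; rewrite !ler_norml => /andP [h1 h2] /andP [h3 h4].
  move: h1 h2 h3 h4; set a := n.+1%:R^-1; set b := m.+1%:R^-1; move: a b => a b h1 h2 h3 h4.
  by lra.
have : cvg (y @ \oo).
  apply: cauchy_cvg; apply: cauchy_exP => e e0.
  have e2 : 0 < e / 2 by rewrite divr_gt0.
  have [N _ NP] := near_infty_natSinv_lt (PosNum e2).
  exists (y N); exists N => // n /= Nn; rewrite -ball_normE /ball_ /=.
  apply: le_lt_trans (ydist N n) _; rewrite [ltRHS]splitr.
  by apply: ltrD; apply: NP => /=.
move=> /cvg_ex [/= l yl]; exists l => f fb.
apply/eqP; rewrite -subr_eq0 -normr_le0; apply/ler_addgt0Pl => e e0; rewrite addr0.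
have e2 : 0 < e / 2 by rewrite divr_gt0.
have /cvgrPdist_lt /(_ _ e2) yle := yl.
have [N /= [h1 h2]] := filter_ex (filterI yle (near_infty_natSinv_lt (PosNum e2))).
have := yP N f fb; have := bounded_form_dist (y N) l fb.
rewrite mul1r distrC -[`|y N - l|]distrC => h3 h4.
rewrite [e]splitr -(subrKA (f (y N))); apply: le_trans (ler_normD _ _) _.
apply: lerD; first by apply: le_trans h4 _; exact: ltW.
by rewrite distrC; apply: le_trans h3 _; exact: ltW.
Qed.

(** Grothendieck's criterion. An ultrafilter on [X] has a limit in the bidual, within [e] of the
    weak limit of nearby points of [Y]; being at distance 0 from [E], it comes from a point of [E]
    by completeness. *)
Lemma rel_weakly_compact_approx (X : set E) :
  (forall e, 0 < e -> exists2 Y, rel_weakly_compact Y &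
     forall x, X x -> exists2 y, Y y & `|x - y| <= e) ->
  rel_weakly_compact X.
Proof.
move=> H U UU UX.
have approx e : 0 < e -> exists2 c : E -> E, U [set x | `|x - c x| <= e] & exists y, wcvg U c y.
  move=> e0; have [Y Yc XY] := H e e0.
  have /choice [c cP] : forall x, exists y, X x -> Y y /\ `|x - y| <= e.
    move=> x; have [/XY [y Yy xy]|nXx] := pselect (X x); first by exists y.
    by exists x.
  exists c; first by apply: filterS UX => x /cP [].
  by apply: (rel_weakly_compact_wcvg UU Yc); apply: filterS UX => x /cP [].
have Ucvg f : bounded_form 1 f -> cvg (f @ U).
  move=> fb; have [c cU [y cy]] := approx 1 ltr01.
  have /cvgrPdist_lt /(_ _ ltr01) fc := cy f fb.
  have [|l] := @ultra_bounded_cvg R E U f (`|f y| + 2) UU; last first.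
    by move=> fl; apply/cvg_ex; exists l.
  apply: filterS (filterI cU fc) => x /= [h1 h2].
  have := bounded_form_dist x (c x) fb; rewrite mul1r => h3.
  have h4 := ler_norm (f y); have h5 := ler_norm (- f y); rewrite normrN in h5.
  move: h2 (le_trans h3 h1); rewrite ltr_norml !ler_norml => /andP [h6 h7] /andP [h8 h9].
  by apply/andP; split; lra.
have [|y yP] := @approx_evaluation (fun f => lim (f @ U)).
  move=> e e0; have [c cU [y cy]] := approx e e0; exists y => f fb.
  have : (fun x => f x - f (c x)) @ U --> lim (f @ U) - f y.
    by apply: cvgB; [exact: Ucvg|exact: cy].
  move=> /cvg_norm_le; apply; apply: filterS cU => x /=; apply: le_trans.
  by have := bounded_form_dist x (c x) fb; rewrite mul1r.
by exists y => f fb; rewrite -yP //; exact: Ucvg.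
Qed.

End Complete.

(** * Krein's theorem *)

(** Each choice may depend on all earlier ones. Histories are total functions of which [Q n] reads
    only the values below [n], as the first hypothesis says; this avoids finite sequences. *)
Lemma strong_dependent_choice (T : Type) (x0 : T) (Q : nat -> (nat -> T) -> T -> Prop) :
  (forall n a a' b, (forall i, (i < n)%N -> a i = a' i) -> Q n a b -> Q n a' b) ->
  (forall n a, (forall i, (i < n)%N -> Q i a (a i)) -> exists b, Q n a b) ->
  exists a, forall n, Q n a (a n).
Proof.
move=> Qext Qex.
have /choice [g gP] : forall na : nat * (nat -> T), exists b,
    (forall i, (i < na.1)%N -> Q i na.2 (na.2 i)) -> Q na.1 na.2 b.
  move=> [n a] /=; have [/Qex [b Qb]|nQ] := pselect (forall i, (i < n)%N -> Q i a (a i)).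
    by exists b.
  by exists x0.
pose step n b := fun i => if i == n then g (n, b) else b i.
pose b := fix b n := if n is m.+1 then step m (b m) else fun=> x0.
pose a n := b n.+1 n.
have ab n i : (i < n)%N -> b n i = a i.
  elim: n => // n IHn; rewrite ltnS leq_eqVlt => /predU1P [->//|i_n].
  by rewrite -IHn //= /step ltn_eqF.
have aE n : a n = g (n, b n) by rewrite /a /= /step eqxx.
exists a; elim/ltn_ind => n IHn.
apply: (@Qext n (b n)); first exact: ab.
rewrite aE; apply: (gP (n, b n)) => /= i i_n; rewrite ab //.
apply: (@Qext i a) (IHn i i_n) => j ji; rewrite ab //; exact: ltn_trans i_n.
Qed.

(** * Intersections of sets of large finitely additive measure *)

Section FiniteIntersections.
Variables (R : realType) (T : Type) (mu : set T -> R).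
Hypotheses (mu_ge0 : forall A, 0 <= mu A) (mu_le1 : forall A, mu A <= 1)
  (mu0 : mu set0 = 0)
  (muS : forall A B, A `<=` B -> mu A <= mu B)
  (muU : forall A B, mu (A `|` B) + mu (A `&` B) = mu A + mu B).

(** Otherwise each late set meets all much later ones in small measure only, and a union of [K] of
    them would have measure more than 1. *)
Lemma frequent_pairs (B : nat -> set T) (d : R) n0 : 0 < d ->
  (forall n, exists2 m, (n <= m)%N & d <= mu (B m)) ->
  exists2 m, (n0 <= m)%N & exists2 d', 0 < d' &
    forall n, exists2 m', (n <= m')%N & d' <= mu (B m `&` B m').
Proof.
move=> d0 Bd.
(* [K * (d / 2)] exceeds 1, and [K * eta = d / 2]: each of the first [K] sets adds at least [d]
   minus an overlap of at most [d / 2]. *)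
pose K := (Num.truncn (2 / d)).+1; pose eta := d / (2 * K%:R).
have K0 : 0 < K%:R :> R by rewrite ltr0n.
have eta0 : 0 < eta by rewrite divr_gt0 // mulr_gt0.
apply: contrapT => H.
have {}H m : (n0 <= m)%N -> exists n, forall m', (n <= m')%N -> mu (B m `&` B m') <= eta.
  move=> n0m; apply: contrapT => H'; apply: H; exists m => //; exists eta => // n.
  apply: contrapT => H''; apply: H'; exists n => m' nm'.
  rewrite leNgt; apply/negP => lt; apply: H''; exists m' => //; exact: ltW.
suff : forall k, (k <= K)%N -> exists2 Y, k%:R * (d / 2) <= mu Y &
    exists n, forall m', (n <= m')%N -> mu (Y `&` B m') <= k%:R * eta.
  move=> /(_ K (leqnn _)) [Y]; have := mu_le1 Y => Y1 KY _.
  have := le_trans KY Y1; rewrite leNgt => /negP; apply.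
  have := truncnS_gt (2 / d); rewrite -/K ltr_pdivrMr //; move: (K%:R) => x; lra.
elim=> [_|k IHk kK].
  exists set0; first by rewrite mul0r.
  by exists 0%N => m' _; rewrite set0I mul0r mu0.
have [Y Yk [n nP]] := IHk (ltnW kK).
have [m nm dm] := Bd (maxn n n0).
move: nm; rewrite geq_max => /andP [nm n0m].
have [n' n'P] := H m n0m.
exists (Y `|` B m).
  have := muU Y (B m); have := nP m nm.
  have : k%:R * eta <= d / 2.
    have -> : d / 2 = K%:R * eta by rewrite /eta; field; rewrite gt_eqF.
    by rewrite ler_pM2r // ler_nat ltnW.
  by rewrite -(@natr1 R k) mulrDl mul1r; move: (k%:R * _) (k%:R * _) Yk => x y; lra.
exists (maxn n n') => m'; rewrite geq_max => /andP [nm' n'm'].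
rewrite setIUl -(@natr1 R k) mulrDl mul1r.
have := muU (Y `&` B m') (B m `&` B m'); have := mu_ge0 ((Y `&` B m') `&` (B m `&` B m')).
have := nP _ nm'; have := n'P _ n'm'; lra.
Qed.

(** The invariant is that infinitely many [A m] meet the intersection built so far in measure at
    least some [d' > 0]. [frequent_pairs] preserves it with another [d'], which may shrink since
    only positivity is claimed. *)
Lemma frequent_intersections (A : nat -> set T) (d : R) : 0 < d ->
  (forall m, d <= mu (A m)) ->
  exists2 e : nat -> nat, (forall i, (i <= e i)%N) &
    forall k, 0 < mu [set z | forall i, (i < k)%N -> A (e i) z].
Proof.
move=> d0 Ad.
pose S (e : nat -> nat) k := [set z | forall i, (i < k)%N -> A (e i) z].
pose freq X := exists2 d', 0 < d' & forall n, exists2 m, (n <= m)%N & d' <= mu (X `&` A m).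
have SS e k b : S e k `&` A b =
    S (fun i => if i == k then b else e i) k.+1.
  apply/seteqP; split => z /=.
    move=> [Sz Ab] i; rewrite ltnS leq_eqVlt => /predU1P [->|ik]; first by rewrite eqxx.
    by rewrite ltn_eqF //; exact: Sz.
  move=> Sz; split=> [i ik|]; last by have := Sz k (ltnSn k); rewrite eqxx.
  by have := Sz i (ltnW ik); rewrite ltn_eqF.
have Sext e e' k : (forall i, (i < k)%N -> e i = e' i) -> S e k = S e' k.
  by move=> ee'; apply/seteqP; split => z Sz i ik; have := Sz i ik; rewrite ee'.
have [|n e IH|e eP] := @strong_dependent_choice nat 0%N
    (fun k e b => (k <= b)%N /\ freq (S e k `&` A b)).
- by move=> n a a' b aa' [h1 h2]; split => //; rewrite -(Sext a).
- have [d' d'0 fS] : freq (S e n).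
    case: n IH => [|n] IH.
      exists d => // n; exists n => //; apply: le_trans (Ad n) _.
      by apply: muS => z Az; split.
    have [_] := IH n (ltnSn n); rewrite SS (_ : S _ _ = S e n.+1) //.
    by apply: Sext => i _; case: eqP => [->|].
  have [m nm [d'' d''0 fm]] := frequent_pairs n d'0 fS.
  exists m; split=> //; exists d'' => // n'; have [m' n'm' dm'] := fm n'.
  exists m' => //; apply: le_trans dm' _; apply: muS => z /= [[h1 h2] [h3 h4]].
  by split.
exists e => [i|k]; first by have [] := eP i.
have [_ [d' d'0 /(_ 0%N) [m _ dm]]] := eP k.
apply: lt_le_trans d'0 (le_trans dm _); apply: muS => z [[Sz _] _]; exact: Sz.
Qed.

End FiniteIntersections.

(** * Functionals on the dual and Helly's lemma *)

Section Helly.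
Variables (R : realType) (E : normedModType R).

(* One-step Hahn-Banach extensions, one for each point of [zs]. *)
Lemma helly (Lam : (E -> R) -> R) theta (zs : seq E) :
  (forall a k l f g, bounded_form k f -> bounded_form l g ->
     Lam (fun x => a * f x + g x) = a * Lam f + Lam g) ->
  (forall k f, 0 <= k -> bounded_form k f -> (forall z, z \in zs -> f z = 0) ->
     Lam f <= theta * k) ->
  exists y, forall k f, 0 <= k -> bounded_form k f -> Lam f - f y <= theta * k.
Proof.
elim: zs Lam => [|z zs IHzs] Lam LamL Lamle.
  by exists 0 => k f k0 fb; rewrite (linear_form0 fb.1) subr0; exact: Lamle.
have combo (a k l : R) (f g : E -> R) : bounded_form k f -> bounded_form l g ->
    bounded_form (`|a| * k + l) (fun x => a * f x + g x).
  by move=> fb gb; exact: bounded_formD (bounded_formZ a fb) gb.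
pose zf : E -> R := fun=> 0.
have zero : bounded_form 0 zf.
  by split=> [a x y|x]; rewrite /zf ?mulr0 ?addr0 // normr0 mul0r.
have LamZ (a k : R) (f : E -> R) : bounded_form k f -> Lam (fun x => a * f x) = a * Lam f.
  move=> fb; have Lam0 : Lam zf = 0.
    have := LamL 1 _ _ _ _ zero zero.
    rewrite (_ : (fun x => 1 * zf x + zf x) = zf) ?mul1r; first by lra.
    by apply/funext => x; rewrite /zf mulr0 addr0.
  have := LamL a _ _ _ _ fb zero; rewrite Lam0 addr0 => <-; congr Lam.
  by apply/funext => x; rewrite addr0.
pose ann (f : E -> R) := forall w, w \in zs -> f w = 0.
(* With such a [c] the functional [Lam f - c * f z] falls under the induction hypothesis, and
   [c *: z] is added to the point found. *)
suff [c cP] : exists c, forall k f, 0 <= k -> bounded_form k f -> ann f ->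
    Lam f - c * f z <= theta * k.
  have [//|k f k0 fb fzs|y yP] := IHzs (fun f => Lam f - c * f z).
  - by move=> a k l f g fb gb; rewrite (LamL a _ _ _ _ fb gb); ring.
  - exact: cP.
  exists (y + c *: z) => k f k0 fb.
  by rewrite (linear_formD fb.1) (linear_formZ fb.1) opprD addrA addrAC yP.
have ann0 f : ann f -> f z = 0 -> forall w, w \in z :: zs -> f w = 0.
  by move=> fzs fz w; rewrite inE => /predU1P [->|/fzs].
have [[g0 [k0 [k0ge g0b g0ann g0z]]]|nog] := pselect (exists g k,
    [/\ 0 <= k, bounded_form k g, ann g & g z != 0]); last first.
  exists 0 => k f kge fb fann; rewrite mul0r subr0; apply: Lamle => //.
  apply: ann0 => //; apply: contrapT => /eqP fz; apply: nog; exists f, k; split => //.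
(* After scaling to value 1 at [z], forms positive at [z] bound [c] from below by elements of [S],
   and forms negative at [z] bound it from above by [Lam h + theta * k]. The bounds are compatible
   by [Sub], because the difference of two scaled forms vanishes on [z :: zs]. *)
pose S := [set r | exists k f, [/\ 0 <= k, bounded_form k f, ann f, f z = 1 &
  r = Lam f - theta * k]].
have normalize (k : R) (f : E -> R) : 0 <= k -> bounded_form k f -> ann f -> f z != 0 ->
    let h x := (f z)^-1 * f x in
    [/\ 0 <= `|(f z)^-1| * k, bounded_form (`|(f z)^-1| * k) h, ann h, h z = 1 &
     Lam h = (f z)^-1 * Lam f].
  move=> kge fb fann fz /=; split.
  - by rewrite mulr_ge0.
  - exact: bounded_formZ.
  - by move=> w wzs; rewrite (fann w wzs) mulr0.
  - by rewrite mulVf.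
  - exact: LamZ fb.
have S0 : S !=set0.
  have [h1 h2 h3 h4 _] := normalize _ _ k0ge g0b g0ann g0z.
  by eexists; do 2 eexists; split; [exact: h1|exact: h2|exact: h3|exact: h4|].
have Sub (k : R) (h : E -> R) : 0 <= k -> bounded_form k h -> ann h -> h z = 1 ->
    ubound S (Lam h + theta * k).
  move=> kge hb hann hz _ [l [f [lge fb fann fz ->]]].
  have db := combo (-1) _ _ _ _ hb fb.
  have := Lamle _ _ _ db; rewrite normrN1 mul1r => /(_ (addr_ge0 kge lge)).
  rewrite (LamL _ _ _ _ _ hb fb) => /(_ _) H.
  suff : -1 * Lam h + Lam f <= theta * (k + l) by lra.
  apply: H; apply: ann0 => [w wzs|]; last by rewrite hz fz; lra.
  by rewrite hann // fann // mulr0 addr0.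
have hasS : has_ubound S.
  have [h1 h2 h3 h4 _] := normalize _ _ k0ge g0b g0ann g0z.
  by eexists; exact: Sub h1 h2 h3 h4.
exists (sup S) => k f kge fb fann.
have [fz|fz] := eqVneq (f z) 0.
  by rewrite fz mulr0 subr0; apply: Lamle => //; exact: ann0.
have [h1 h2 h3 h4 h5] := normalize _ _ kge fb fann fz.
have [fz0|fz0] := ltP 0 (f z).
  have : Lam (fun x => (f z)^-1 * f x) - theta * (`|(f z)^-1| * k) <= sup S.
    by apply: ub_le_sup => //; eexists; eexists; split; [exact: h1|exact: h2|exact: h3|exact: h4|].
  rewrite h5 gtr0_norm ?invr_gt0 // mulrCA -mulrBr ler_pdivrMl //; lra.
have {}fz0 : f z < 0 by rewrite lt_neqAle fz.
have : sup S <= Lam (fun x => (f z)^-1 * f x) + theta * (`|(f z)^-1| * k).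
  by apply: ge_sup => //; exact: Sub.
rewrite h5 ltr0_norm ?invr_lt0 // mulrCA mulNr -mulrBr ler_ndivlMl //; lra.
Qed.

End Helly.

(** * Convex combinations as discrete measures *)

Section ConvexHull.
Variables (R : realType) (E : normedModType R).
Implicit Types (s : seq (R * E)) (P : set E).

Definition barycenter s : E := \sum_(p <- s) p.1 *: p.2.
Definition mass s (A : set E) : R := \sum_(p <- s) p.1 * (p.2 \in A)%:R.
Definition weighting P s :=
  (forall p, p \in s -> 0 <= p.1 /\ P p.2) /\ \sum_(p <- s) p.1 = 1.
Definition hull P : set E := [set u | exists2 s, weighting P s & u = barycenter s].

Lemma form_barycenter f s : linear_form f ->
  f (barycenter s) = \sum_(p <- s) p.1 * f p.2.
Proof.
move=> fl; rewrite /barycenter; elim: s => [|p s IHs]; first by rewrite !big_nil linear_form0.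
by rewrite !big_cons fl IHs.
Qed.

Lemma weighting_sum_le P s (g h : R * E -> R) : weighting P s ->
  (forall p, P p.2 -> g p <= h p) ->
  \sum_(p <- s) p.1 * g p <= \sum_(p <- s) p.1 * h p.
Proof.
move=> [sP _] gh; rewrite big_seq [leRHS]big_seq; apply: ler_sum => p ps.
by have [p0 Pp] := sP p ps; rewrite ler_wpM2l // gh.
Qed.

Lemma hull_norm_le P M u : (forall z, P z -> `|z| <= M) -> hull P u -> `|u| <= M.
Proof.
move=> PM [s sP ->]; apply: le_trans (ler_norm_sum _ _ _) _.
have -> : \sum_(p <- s) `|p.1 *: p.2| = \sum_(p <- s) p.1 * `|p.2|.
  by apply: eq_big_seq => p /sP.1 [p0 _]; rewrite normrZ ger0_norm.
have : \sum_(p <- s) p.1 * `|p.2| <= \sum_(p <- s) p.1 * M.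
  by apply: (weighting_sum_le sP) => p; exact: PM.
by rewrite -mulr_suml sP.2 mul1r.
Qed.

Lemma sub_hull P : P `<=` hull P.
Proof.
move=> z Pz; exists [:: (1, z)]; last by rewrite /barycenter big_seq1 scale1r.
by split=> [p|]; rewrite ?big_seq1 // inE => /eqP ->.
Qed.

Lemma hull_conv P u v t : hull P u -> hull P v -> 0 <= t -> t <= 1 ->
  hull P (t *: u + (1 - t) *: v).
Proof.
move=> [s [sP s1] ->] [s' [s'P s'1] ->] t0 t1.
pose sc a s := [seq (a * p.1, p.2) | p <- s] : seq (R * E).
exists (sc t s ++ sc (1 - t) s').
  split=> [p|].
    rewrite mem_cat => /orP [] /mapP [q qs ->] /=.
      by have [q0 Pq] := sP q qs; rewrite mulr_ge0.
    by have [q0 Pq] := s'P q qs; rewrite mulr_ge0 // subr_ge0.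
  by rewrite big_cat !big_map /= -!mulr_sumr s1 s'1 !mulr1 addrC subrK.
rewrite /barycenter big_cat !big_map /= !scaler_sumr.
by congr (_ + _); apply: eq_bigr => p _; rewrite scalerA.
Qed.

Section Mass.
Variables (P : set E) (s : seq (R * E)).
Hypothesis sP : weighting P s.

Lemma mass_ge0 A : 0 <= mass s A.
Proof.
by rewrite /mass big_seq; apply: sumr_ge0 => p /sP.1 [p0 _]; rewrite mulr_ge0 // ler0n.
Qed.

Lemma massS A B : A `<=` B -> mass s A <= mass s B.
Proof.
move=> AB; apply: (weighting_sum_le sP) => p _; rewrite ler_nat.
by have [/set_mem /AB /mem_set ->|] := boolP (p.2 \in A).
Qed.

Lemma mass_le1 A : mass s A <= 1.
Proof.
rewrite -sP.2 -[leRHS](eq_bigr _ (fun p _ => mulr1 p.1)).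
by apply: (weighting_sum_le sP) => p _; rewrite lern1 leq_b1.
Qed.

Lemma massU A B : mass s (A `|` B) + mass s (A `&` B) = mass s A + mass s B.
Proof.
rewrite /mass -!big_split /=; apply: eq_bigr => p _; rewrite -!mulrDr -!natrD.
by rewrite in_setU in_setI; case: (p.2 \in A); case: (p.2 \in B).
Qed.

Lemma mass0 : mass s set0 = 0.
Proof. by rewrite /mass big1 // => p _; rewrite in_set0 mulr0. Qed.

Lemma mass_gt0 A : 0 < mass s A -> exists2 p, p \in s & A p.2.
Proof.
move=> A0; apply: contrapT => H; move: A0; rewrite /mass big_seq big1 ?ltxx // => p ps.
case: (boolP (p.2 \in A)) => [/set_mem Ap|_]; last by rewrite mulr0.
by case: H; exists p.
Qed.

(** A Markov inequality: [f] is at most [M] on the points where it exceeds [t], and at most [t] on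
    the others. *)
Lemma form_mass_le f t M : bounded_form 1 f -> 0 <= M -> 0 <= t ->
  (forall z, P z -> `|z| <= M) ->
  f (barycenter s) <= M * mass s [set z | t < f z] + t.
Proof.
move=> fb M0 t0 PM; rewrite (form_barycenter _ fb.1) /mass mulr_sumr.
rewrite -[X in _ + X]mulr1 -[in X in _ + X]sP.2 mulr_sumr -big_split /=.
rewrite [leRHS](eq_bigr (fun p => p.1 * (M * (p.2 \in [set z | t < f z])%:R + t))).
  apply: (weighting_sum_le sP) => p Pp.
  have fM : f p.2 <= M.
    apply: le_trans (ler_norm _) (le_trans (fb.2 _) _); rewrite mul1r; exact: PM.
  have [_|] := boolP (p.2 \in _); first by rewrite mulr1; lra.
  by move/negP; rewrite in_setE /= => /negP; rewrite -leNgt mulr0 add0r.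
by move=> p _; ring.
Qed.

End Mass.
End ConvexHull.

Section Krein.
Variables (R : realType) (E : completeNormedModType R).

Lemma ultra_infinite (V : set_system nat) n : ProperFilter V ->
  \oo `<=` V -> V [set i | (n <= i)%N].
Proof. by move=> PV oV; apply: oV; exists n. Qed.

(* If an ultrafilter on [hull P] has a limit [Lam] in the bidual at distance more
   than [theta] from [E], there are forms [f_m] of norm 1 and weightings [s_n] on [P]
   such that [f_m] vanishes on [s_n] for [n < m] and has mean more than [theta] on
   [s_n] for [n >= m].  In the limit the masses of the [s_n] give a finitely additive
   measure for which the sets [f_m > theta / 2] have measure bounded from below, so
   some subsequence of them has the finite intersection property; this produces
   points [z_k] of [P] without weak cluster point. *)
Theorem krein (P : set E) (M : R) : (forall z, P z -> `|z| <= M) ->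
  (forall x, (forall n, P (x n)) -> subseq_wcvg x) ->
  rel_weakly_compact (hull P).
Proof.
move=> PM Pseq U UU UP; apply: contrapT => noy.
have [M' M'0 {M} PM] : exists2 M', 0 < M' & forall z, P z -> `|z| <= M'.
  exists (Num.max M 1); first by rewrite lt_max ltr01 orbT.
  by move=> z /PM h; rewrite le_max h.
move: M' PM M'0 => {}M PM M0.
have Ucvg k (f : E -> R) : bounded_form k f -> cvg (f @ U).
  move=> /bounded_form1; set k' := Num.max k 1 => fb.
  have k'0 : 0 <= k' by rewrite le_max ler01 orbT.
  have [|l fl] := @ultra_bounded_cvg R E U f (k' * M) UU; last by apply/cvg_ex; exists l.
  apply: filterS UP => u /(hull_norm_le PM) uM /=.
  by apply: le_trans (fb.2 u) _; rewrite ler_wpM2l.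
pose Lam (f : E -> R) : R := lim (f @ U).
have LamL (a k l : R) (f g : E -> R) : bounded_form k f -> bounded_form l g ->
    Lam (fun x => a * f x + g x) = a * Lam f + Lam g.
  move=> /Ucvg fU /Ucvg gU; apply/cvg_lim => //.
  by apply: cvgD => //; exact: (@cvgMl_tmp _ _ U _ _ _ _ fU).
have zf : bounded_form 0 (fun _ : E => 0 : R).
  by split=> [b x y|x]; rewrite ?mulr0 ?addr0 // normr0 mul0r.
have Lam0 : Lam (fun=> 0) = 0 by apply/cvg_lim => //; exact: cvg_cst.
have LamZ (a k : R) (f : E -> R) : bounded_form k f -> Lam (fun x => a * f x) = a * Lam f.
  move=> fb; have := LamL a _ _ _ _ fb zf; rewrite Lam0 addr0 => <-; congr Lam.
  by apply/funext => x; rewrite addr0.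
(* Otherwise [Lam] is within every [theta] of an evaluation, hence is one. A one-sided bound is
   enough because the opposite form is also available. *)
have [theta theta0 far] : exists2 theta, 0 < theta & forall y, exists2 f : E -> R,
    bounded_form 1 f & theta < Lam f - f y.
  apply: contrapT => H; apply: noy.
  have [|y yP] := @approx_evaluation R E Lam; last first.
    by exists y => f fb; rewrite -yP //; exact: Ucvg fb.
  move=> e e0; apply: contrapT => H'; apply: H; exists e => // y.
  apply: contrapT => H''; apply: H'; exists y => f fb.
  rewrite ler_norml; apply/andP; split; rewrite leNgt; apply/negP => lt; apply: H''.
    exists (fun x => -1 * f x).
      by have := bounded_formZ (-1) fb; rewrite normrN1 mulr1.
    by rewrite (LamZ _ _ _ fb); lra.
  by exists f.
(* If [Lam] were at most [theta] on the forms vanishing on [zs], Helly's lemma would give a [y] that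
   contradicts [far]. *)
have far_ann (zs : seq E) : exists f : E -> R, [/\ bounded_form 1 f,
    forall z, z \in zs -> f z = 0 & theta < Lam f].
  apply: contrapT => H.
  have [k f k0 fb fzs|y yP] := @helly R E Lam theta zs LamL; last first.
    have [f fb flt] := far y; have := yP 1 f ler01 fb; rewrite mulr1; lra.
  rewrite leNgt; apply/negP => lt.
  have kgt0 : 0 < k.
    rewrite lt_neqAle k0 andbT; apply/eqP => k0'; move: lt; rewrite -k0' mulr0.
    rewrite (_ : f = fun=> 0) ?Lam0 ?ltxx //; apply/funext => x.
    by apply/eqP; rewrite -normr_le0; have := fb.2 x; rewrite -k0' mul0r.
  apply: H; exists (fun x => k^-1 * f x); split.
  - by have := bounded_formZ k^-1 fb; rewrite gtr0_norm ?invr_gt0 // mulVf ?gt_eqF.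
  - by move=> z zzs; rewrite fzs // mulr0.
  - by rewrite (LamZ _ _ _ fb) ltr_pdivlMl // mulrC.
pose T := ((E -> R) * seq (R * E))%type.
(* At each stage the form is chosen to kill the supports of all earlier weightings; the ultrafilter
   then provides one point of [hull P] at which this form and the earlier ones exceed [theta]. *)
have [|n a IH|a aP] := @strong_dependent_choice T (fun=> 0, [::]) (fun n a b =>
    [/\ bounded_form 1 b.1, theta < Lam b.1, weighting P b.2, theta < b.1 (barycenter b.2) &
     forall i, (i < n)%N -> (forall p, p \in (a i).2 -> b.1 p.2 = 0) /\
        theta < (a i).1 (barycenter b.2)]).
- by move=> n a a' b aa' [h1 h2 h3 h4 h5]; split => // i i_n; rewrite -aa' //; exact: h5.
- have [f [fb fz Lf]] := far_ann (flatten [seq [seq p.2 | p <- (a i).2] | i <- iota 0 n]).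
  have Unear g : bounded_form 1 g -> theta < Lam g -> U [set u | theta < g u].
    move=> gb Lg; have /cvgrPdist_lt /(_ (Lam g - theta)) := Ucvg _ _ gb.
    rewrite subr_gt0 => /(_ Lg); apply: filterS => u.
    by rewrite -/(Lam g) ltr_norml => /andP [_] /= h; lra.
  have Uall : forall m, (m <= n)%N -> U [set u | forall i, (i < m)%N -> theta < (a i).1 u].
    elim=> [_|m IHm mn]; first by apply: filterS (filterT : U setT) => u _ i.
    have [gb Lg _ _ _] := IH m mn.
    apply: filterS (filterI (IHm (ltnW mn)) (Unear _ gb Lg)) => u [h1 h2] i.
    by rewrite ltnS leq_eqVlt => /predU1P [->//|]; exact: h1.
  have [u [[[s sP ->] fu] au]] :=
    filter_ex (filterI (filterI UP (Unear _ fb Lf)) (Uall n (leqnn n))).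
  exists (f, s); split => // i i_n; split; last exact: au.
  move=> p ps; apply: fz; apply/flattenP; exists [seq p.2 | p <- (a i).2].
    by apply/mapP; exists i; rewrite // mem_iota.
  by apply/mapP; exists p.
pose f n := (a n).1; pose s n := (a n).2.
have fb n : bounded_form 1 (f n) by have [] := aP n.
have sP n : weighting P (s n) by have [] := aP n.
have f0 m n p : (n < m)%N -> p \in s n -> f m p.2 = 0.
  by move=> nm ps; have [_ _ _ _ /(_ n nm) [/(_ p ps)]] := aP m.
have fgt m n : (m <= n)%N -> theta < f m (barycenter (s n)).
  rewrite leq_eqVlt => /predU1P [->|mn]; first by have [] := aP n.
  by have [_ _ _ _ /(_ m mn) []] := aP n.
have [V [VU oV]] := ultraFilterLemma eventually_filter.
have mass_cvg A : cvg ((fun n => mass (s n) A) @ V).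
  have [|l ?] := @ultra_bounded_cvg R nat V (fun n => mass (s n) A) 1 VU; last first.
    by apply/cvg_ex; exists l.
  apply: filterS (filterT : V setT) => n _ /=.
  by rewrite ger0_norm ?(mass_ge0 (sP n)) // (mass_le1 (sP n)).
pose mu A : R := lim ((fun n => mass (s n) A) @ V).
have half : 0 < theta / 2 by rewrite divr_gt0.
have VT (B : set nat) : (forall n, B n) -> V B.
  by move=> HB; apply: filterS (filterT : V setT) => n _; exact: HB.
have muge A m : V [set n | m <= mass (s n) A] -> m <= mu A.
  exact: ge_of_cvg (mass_cvg A).
have mule A m : V [set n | mass (s n) A <= m] -> mu A <= m.
  exact: le_of_cvg (mass_cvg A).
have mu_cvg A : mass (s n) A @[n --> V] --> mu A by exact: mass_cvg.
(* By [form_mass_le] at [t = theta / 2], a mean above [theta] leaves mass at least [theta / 2 / M]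
   to [A m]. *)
have d0 : 0 < theta / 2 / M by rewrite divr_gt0.
pose A m := [set z | theta / 2 < f m z].
have muA m : theta / 2 / M <= mu (A m).
  apply: muge; apply: oV; exists m => // n mn /=.
  rewrite ler_pdivrMr // mulrC.
  have := form_mass_le (sP n) (fb m) (ltW M0) (ltW half) PM.
  by have := fgt m n mn; rewrite -/(A m); lra.
have [|||||e ei eP] := @frequent_intersections R E mu _ _ _ _ _ A _ d0 muA.
- by move=> B; apply: muge; apply: VT => n; exact: mass_ge0 (sP n) B.
- by move=> B; apply: mule; apply: VT => n; exact: mass_le1 (sP n) B.
- apply/eqP; rewrite eq_le; apply/andP; split.
    by apply: mule; apply: VT => n /=; rewrite mass0.
  by apply: muge; apply: VT => n /=; rewrite mass0.
- move=> B C BC; rewrite -subr_ge0; apply: (ge_of_cvg _ (cvgB (mu_cvg C) (mu_cvg B))).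
  by apply: VT => n; rewrite /= subr_ge0; exact: massS (sP n) _ _ BC.
- move=> B C; have h1 : (fun n => mass (s n) B + mass (s n) C) @ V -->
      mu (B `|` C) + mu (B `&` C).
    rewrite (_ : (fun n => _) = (fun n => mass (s n) (B `|` C) + mass (s n) (B `&` C))).
      exact: cvgD.
    by apply/funext => n; rewrite massU.
  by apply: (cvgR_unique _ h1); exact: cvgD.
have /choice [z zP] : forall k, exists z, (exists n, exists2 p, p \in s n & z = p.2) /\
    forall i, (i < k)%N -> theta / 2 < f (e i) z.
  move=> k; have [n sn] : exists n, 0 < mass (s n) [set z | forall i, (i < k)%N -> A (e i) z].
    apply: contrapT => H; have := eP k; rewrite ltNge => /negP; apply.
    apply: mule; apply: VT => n /=; rewrite leNgt; apply/negP => lt; apply: H.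
    by exists n.
  have [p ps Ap] := mass_gt0 sn; exists p.2; split; last exact: Ap.
  by exists n, p.
have Pz k : P (z k).
  by have [[n [p ps ->]] _] := zP k; have [] := (sP n).1 p ps.
have [e' e'i [y zy]] := Pseq z Pz.
have fcvg x : cvg ((fun i => f (e i) x) @ V).
  have [|l ?] := @ultra_bounded_cvg R nat V (fun i => f (e i) x) `|x| VU; last first.
    by apply/cvg_ex; exists l.
  by apply: VT => i /=; have := (fb (e i)).2 x; rewrite mul1r.
(* Two iterated limits disagree. The limit form [finf] vanishes at each [z k], since late forms kill
   earlier supports, and hence at [y]. But each [f (e i)] exceeds [theta / 2] at [z k] for [k > i],
   so [finf y] is at least [theta / 2]. *)
pose finf x : R := lim ((fun i => f (e i) x) @ V).
have finf_cvg x : f (e i) x @[i --> V] --> finf x by exact: fcvg.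
have finfb : bounded_form 1 finf.
  split=> [b x x'|x].
    apply/cvg_lim => //.
    rewrite (_ : (fun i => _) = (fun i => b * f (e i) x + f (e i) x')); last first.
      by apply/funext => i; rewrite (fb (e i)).1.
    by apply: cvgD; [exact: (@cvgMl_tmp _ _ V _ _ _ _ (finf_cvg x))|exact: finf_cvg].
  by apply: (cvg_norm_le _ (finf_cvg x)); apply: VT => i; exact: (fb (e i)).2.
have finfz k : finf (z k) = 0.
  apply: (cvgR_unique _ (finf_cvg (z k))); apply: cvg_near_cst.
  have [[n [p ps ->]] _] := zP k; apply: oV; exists n.+1 => // i ni /=.
  by apply: (f0 _ n) => //; exact: leq_trans ni (ei i).
have finfy0 : finf y = 0.
  apply: (cvgR_unique _ (zy finf finfb)); apply: cvg_near_cst.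
  by apply: nearW => k /=; rewrite finfz.
have : theta / 2 <= finf y.
  apply: (ge_of_cvg _ (finf_cvg y)); apply: VT => i /=.
  apply: (ge_of_cvg _ (zy (f (e i)) (fb (e i)))); exists i.+1 => // k ik /=.
  by apply: ltW; apply: (zP (e' k)).2; exact: leq_trans ik (e'i k).
by rewrite finfy0 leNgt half.
Qed.
End Krein.

(** * Weakly convergent subsequences *)

Section ClosedConvex.
Variables (R : realType) (E : normedModType R).

Lemma closureE_norm (Y : set E) a :
  closure Y a <-> forall e : R, 0 < e -> exists2 b, Y b & `|a - b| < e.
Proof.
split=> [cY e e0|H B /nbhs_ballP [e /= e0 eB]].
  have [|b [Yb]] := cY (ball a e); first exact: nbhsx_ballx.
  by rewrite -ball_normE; exists b.
by have [b Yb ab] := H e e0; exists b; split => //; apply: eB; rewrite -ball_normE.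
Qed.

Lemma closure_convex (Y : set E) :
  (forall a b (q : R) (e : R), Y a -> Y b -> 0 <= q -> q <= 1 -> 0 < e ->
     exists2 c, Y c & `|q *: a + (1 - q) *: b - c| < e) ->
  is_convex (closure Y).
Proof.
move=> HY; apply/is_convexP => a b q /closureE_norm Ya /closureE_norm Yb q0 q1.
apply/closureE_norm => e e0; have e2 : 0 < e / 2 by rewrite divr_gt0.
have [a' Ya' aa'] := Ya _ e2; have [b' Yb' bb'] := Yb _ e2.
have [c Yc abc] := HY a' b' q _ Ya' Yb' q0 q1 e2.
exists c => //.
have -> : q *: a + (1 - q) *: b - c =
    (q *: (a - a') + (1 - q) *: (b - b')) + (q *: a' + (1 - q) *: b' - c).
  by rewrite !scalerBr [X in _ = X + _]addrACA -opprD addrA subrK.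
rewrite [e]splitr; apply: le_lt_trans (ler_normD _ _) _; apply: ler_ltD => //.
apply: le_trans (ler_normD _ _) _; rewrite !normrZ !ger0_norm ?subr_ge0 //.
have : q * `|a - a'| <= q * (e / 2) by rewrite ler_wpM2l // ltW.
have : (1 - q) * `|b - b'| <= (1 - q) * (e / 2) by rewrite ler_wpM2l ?subr_ge0 // ltW.
lra.
Qed.

Lemma is_convex_hull (M : set E) : is_convex (closed_convex_hull M).
Proof.
apply/is_convexP => x y s Mx My s0 s1 N [[clN cN] MN].
by move/is_convexP: (cN); apply => //; [exact: Mx|exact: My].
Qed.

Lemma closed_hull (M : set E) : closed (closed_convex_hull M).
Proof. by apply: closed_bigI => N [[]]. Qed.

Lemma sub_closed_hull (M : set E) : M `<=` closed_convex_hull M.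
Proof. by move=> x Mx N [_]; exact. Qed.

Lemma closed_hull_min (M N : set E) : closed N -> is_convex N -> M `<=` N ->
  closed_convex_hull M `<=` N.
Proof. by move=> clN cN MN x; apply; split. Qed.

(** The rational combinations [ev s] are countable and come near every point of the closed hull; [g]
    lists a norming form for each. If all of these agree at [y] and [z], the form norming some
    [ev s1] close to [y - z] vanishes at [y - z], so [ev s1] is small, and [y - z] with it. *)
Lemma separating_forms (x : nat -> E) : exists2 g : nat -> E -> R,
  (forall k, bounded_form 1 (g k)) &
  forall y z, closed_convex_hull (range x) y -> closed_convex_hull (range x) z ->
    (forall k, g k y = g k z) -> y = z.
Proof.
pose ev (s : seq (rat * nat)) : E := \sum_(p <- s) (ratr p.1 : R) *: x p.2.
have /choice [f fP] : forall s, exists f : E -> R, bounded_form 1 f /\ f (ev s) = `|ev s|.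
  by move=> s; have [f fb fs] := norming_form (ev s); exists f.
pose Y := range ev.
have evZD (q : rat) s s' : exists s'', ev s'' = (ratr q : R) *: ev s + ev s'.
  exists ([seq (q * p.1, p.2) | p <- s] ++ s'); rewrite /ev big_cat big_map /= scaler_sumr.
  by congr (_ + _); apply: eq_bigr => p _; rewrite rmorphM scalerA.
have subY : closed_convex_hull (range x) `<=` closure Y.
  apply: closed_hull_min; first exact: closed_closure.
    apply: closure_convex => _ _ q e [s _ <-] [s' _ <-] q0 q1 e0.
    pose M := `|ev s - ev s'| + 1.
    have M0 : 0 < M by rewrite ltr_wpDl.
    have [|r] := @rat_in_itvoo R q (q + e / M); first by rewrite ltrDl divr_gt0.
    rewrite in_itv /= => /andP [qr re].
    have [s1 s1E] := evZD (-1)%R s' s; have [s2 s2E] := evZD r s1 s'.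
    exists (ev s2); first by exists s2.
    rewrite s2E s1E rmorphN1 scaleN1r [- _ + _]addrC.
    have -> : q *: ev s + (1 - q) *: ev s' = q *: (ev s - ev s') + ev s'.
      by rewrite scalerBr scalerBl scale1r addrA [RHS]addrAC.
    rewrite opprD addrACA subrr addr0 -scalerBl normrZ distrC ger0_norm ?subr_ge0 ?(ltW qr) //.
    have : (ratr r - q) * `|ev s - ev s'| <= (ratr r - q) * M.
      by rewrite ler_wpM2l ?subr_ge0 ?(ltW qr) // /M lerDl.
    move/le_lt_trans; apply; rewrite -ltr_pdivlMr //; lra.
  by move=> _ [n _ <-]; apply: subset_closure; exists [:: (1, n)];
    rewrite // /ev big_seq1 /= rmorph1 scale1r.
exists (fun k => if unpickle k is Some s then f s else f [::]).
  by move=> k; case: unpickle => [s|]; exact: (fP _).1.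
move=> y z hy hz fyz.
have yY := (closureE_norm _ _).1 (subY y hy); have zY := (closureE_norm _ _).1 (subY z hz).
apply/eqP; rewrite -subr_eq0 -normr_le0; apply/ler_addgt0Pl => e e0; rewrite addr0.
have e4 : 0 < e / 4 by rewrite divr_gt0.
have [_ [s _ <-] ys] := yY _ e4; have [_ [s' _ <-] zs'] := zY _ e4.
have [s1 s1E] := evZD (-1)%R s' s; rewrite rmorphN1 scaleN1r [- _ + _]addrC in s1E.
have [f1b f1E] := fP s1.
have f1yz : f s1 y = f s1 z by have := fyz (pickle s1); rewrite pickleK.
have ysz : `|(y - z) - ev s1| <= e / 2.
  have -> : y - z - ev s1 = (y - ev s) - (z - ev s').
    by rewrite s1E !opprB [ev s' - _]addrC addrACA [- z + _]addrC.
  apply: le_trans (ler_normB _ _) _; move: (`|y - ev s|) (`|z - ev s'|) ys zs' => b c; lra.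
have := bounded_form_dist (y - z) (ev s1) f1b.
rewrite (linear_formB f1b.1) f1yz subrr f1E mul1r sub0r normrN normr_id => h1.
have := ler_distD (ev s1) (y - z) 0; rewrite !subr0; lra.
Qed.

Lemma wcvg_closed_hull (T : Type) (U : set_system T) (g : T -> E) (M : set E) y :
  ProperFilter U -> U [set t | M (g t)] -> wcvg U g y -> closed_convex_hull M y.
Proof.
move=> PU gM gy; apply: (wcvg_closed_convex PU (@closed_hull M) (@is_convex_hull M) _ gy).
by apply: filterS gM => t; exact: sub_closed_hull.
Qed.

Lemma filter_initial (U : set_system nat) (A : nat -> set nat) j : Filter U ->
  (forall k, U (A k)) -> U [set i | forall k, (k <= j)%N -> A k i].
Proof.
move=> FU UA; elim: j => [|j IHj].
  by apply: filterS (UA 0%N) => i Ai k; rewrite leqn0 => /eqP ->.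
apply: filterS (filterI IHj (UA j.+1)) => i [h1 h2] k.
by rewrite leq_eqVlt => /predU1P [->//|]; exact: h1.
Qed.

(** One half of the Eberlein-Smulian theorem. The subsequence follows an ultrafilter limit [y] on
    the countably many separating forms. Were another form to keep infinitely many terms away from
    [y], an ultrafilter limit [z] of those terms would agree with [y] on the separating forms, hence
    equal [y]. *)
Theorem rel_weakly_compact_subseq (X : set E) (x : nat -> E) :
  rel_weakly_compact X -> (forall n, X (x n)) -> subseq_wcvg x.
Proof.
move=> Xc Xx; have [g gb gsep] := separating_forms x.
have [V [VU oV]] := ultraFilterLemma eventually_filter.
have VT (B : set nat) : (forall n, B n) -> V B.
  by move=> HB; apply: filterS (filterT : V setT) => n _; exact: HB.
have [y Vy] := rel_weakly_compact_wcvg VU Xc (VT _ Xx).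
have /choice [e eP] : forall j, exists i, (j <= i)%N /\
    forall k, (k <= j)%N -> `|g k y - g k (x i)| < j.+1%:R^-1.
  move=> j; have Vk k : V [set i | `|g k y - g k (x i)| < j.+1%:R^-1].
    by have /cvgrPdist_lt := Vy _ (gb k); apply; rewrite invr_gt0 ltr0n.
  have [i [h1 h2]] := filter_ex (filterI (ultra_infinite j _ oV) (filter_initial j _ Vk)).
  by exists i.
exists e => [n|]; first by have [] := eP n.
exists y => f fb; apply/cvgrPdist_lt => eps eps0; apply: contrapT => H.
have /choice [e' e'P] : forall N, exists j, (N <= j)%N /\ eps <= `|f y - f (x (e j))|.
  move=> N; apply: contrapT => H'; apply: H; exists N => // j Nj /=.
  by rewrite ltNge; apply/negP => lt; apply: H'; exists j.
have [z Vz] := rel_weakly_compact_wcvg VU Xc (VT _ (fun n => Xx (e (e' n)))).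
have hull_lim i w : wcvg V (x \o i) w -> closed_convex_hull (range x) w.
  by move=> Vw; apply: (wcvg_closed_hull _ _ Vw); apply: VT => n; exists (i n).
have yz : y = z.
  apply: gsep => [||k]; [exact: (hull_lim id)|exact: (hull_lim (e \o e'))|].
  apply: (cvgR_unique _ _ (Vz _ (gb k))); apply/cvgrPdist_lt => d d0.
  have : V [set n | (k <= n)%N /\ n.+1%:R^-1 < d].
    apply: filterI; first exact: ultra_infinite.
    exact/oV/(near_infty_natSinv_lt (PosNum d0)).
  apply: filterS => n /= [kn nd]; have [ne' _] := e'P n.
  have [_ /(_ k (leq_trans kn ne'))] := eP (e' n); move/lt_trans; apply.
  by apply: le_lt_trans nd; rewrite lef_pV2 ?posrE ?ltr0n // ler_nat ltnS.
have /cvgrPdist_lt /(_ _ eps0) fV := Vz f fb.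
have [n] := filter_ex fV; rewrite /= -yz ltNge.
by have [_ ->] := e'P n.
Qed.

End ClosedConvex.

(** * Approximate fixed points *)

Section Approx.
Variables (R : realType) (E : normedModType R).

Lemma hull_sub_closed_convex (P Z : set E) :
  closed Z -> is_convex Z -> P `<=` Z -> hull P `<=` Z.
Proof.
move=> clZ cZ PZ u [s sP uE]; apply: contrapT => nZu.
have [f fb [d d0 fd]] := separation cZ clZ nZu.
have : \sum_(p <- s) p.1 * (f u + d) <= \sum_(p <- s) p.1 * f p.2.
  by apply: (weighting_sum_le sP) => p /PZ; exact: fd.
by rewrite -mulr_suml sP.2 mul1r -(form_barycenter _ fb.1) -uE gerDl leNgt d0.
Qed.

(** Bisection: the point to approximate lies in one half of the segment, whose ends are again in
    [D]; each halving halves the distance to an end. *)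
Lemma closure_midpoint_convex (D : set E) :
  (forall a b, D a -> D b -> D (2^-1 *: a + 2^-1 *: b)) -> is_convex (closure D).
Proof.
move=> Dmid; apply: closure_convex => a b q e Da Db q0 q1 e0.
have dyadic n : forall a b q, D a -> D b -> 0 <= q -> q <= 1 ->
    exists2 c, D c & `|q *: a + (1 - q) *: b - c| <= `|a - b| * 2^-1 ^+ n.
  elim: n => [|n IHn] {a b Da Db} {q q0 q1} a b q Da Db q0 q1.
    exists b => //; rewrite expr0 mulr1 scalerBl scale1r addrA addrAC addrK.
    by rewrite -scalerBr normrZ ger0_norm // ler_piMl.
  pose m := 2^-1 *: a + 2^-1 *: b.
  have half2 (x : E) : x = 2^-1 *: x + 2^-1 *: x.
    by rewrite -scalerDl (_ : 2^-1 + 2^-1 = 1 :> R) ?scale1r //; lra.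
  have [q2|q2] := leP q 2^-1.
    have [||c Dc cE] := IHn m b (q *+ 2) (Dmid _ _ Da Db) Db; [by lra|by lra|].
    exists c => //; rewrite exprS mulrA.
    have -> : q *: a + (1 - q) *: b = (q *+ 2) *: m + (1 - q *+ 2) *: b.
      rewrite /m scalerDr !scalerA -addrA -scalerDl.
      by congr (_ *: _ + _ *: _); rewrite mulr2n; lra.
    have mb : `|m - b| = `|a - b| * 2^-1.
      rewrite /m {2}(half2 b) opprD addrACA subrr addr0 -scalerBr normrZ mulrC.
      by rewrite gtr0_norm // invr_gt0.
    by rewrite -mb.
  have [||c Dc cE] := IHn a m (q *+ 2 - 1) Da (Dmid _ _ Da Db); [by lra|by lra|].
  exists c => //; rewrite exprS mulrA.
  have -> : q *: a + (1 - q) *: b = (q *+ 2 - 1) *: a + (1 - (q *+ 2 - 1)) *: m.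
    rewrite /m scalerDr !scalerA addrA -scalerDl.
    by congr (_ *: _ + _ *: _); rewrite mulr2n; lra.
  have am : `|a - m| = `|a - b| * 2^-1.
    rewrite /m {1}(half2 a) opprD addrACA subrr add0r -scalerBr normrZ mulrC.
    by rewrite gtr0_norm // invr_gt0.
  by rewrite -am.
have : (fun n => `|a - b| * 2^-1 ^+ n) @ \oo --> `|a - b| * 0.
  apply: cvgMl_tmp; apply: cvg_expr; rewrite ger0_norm ?invr_ge0 //; lra.
rewrite mulr0 => /cvgrPdist_lt /(_ _ e0) /filter_ex [n].
rewrite sub0r normrN ger0_norm ?mulr_ge0 ?exprn_ge0 ?invr_ge0 // => nlt.
have [c Dc cle] := dyadic n a b q Da Db q0 q1.
by exists c => //; exact: le_lt_trans cle nlt.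
Qed.

(** The values of the first [m] forms are rounded to a grid of step [w], and a cell is a vector of
    rounded values. [p] picks a point of [D] in each cell that [D] meets, and [d0] for the other
    cells. *)
Lemma finite_net (D : set E) (M : R) (g : nat -> E -> R) m (w : R) (d0 : E) :
  0 < w -> D d0 -> (forall k d, D d -> `|g k d| <= M) ->
  exists (I : finType) (cell : E -> I) (p : I -> E),
    (forall i, D (p i)) /\
    forall d k, D d -> (k < m)%N -> `|g k d - g k (p (cell d))| < w.
Proof.
move=> w0 Dd0 gM.
pose B := Num.truncn ((M + M) / w).
pose num d k := Num.truncn ((g k d + M) / w).
have g0 d k : D d -> 0 <= (g k d + M) / w.
  move=> /(gM k); rewrite ler_norml => /andP [h1 h2]; rewrite divr_ge0 ?(ltW w0) //; lra.
have numB d k : D d -> (num d k < B.+1)%N.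
  move=> Dd; rewrite ltnS; apply: le_truncn; rewrite ler_pM2r ?invr_gt0 //.
  by move: (gM k d Dd); rewrite ler_norml => /andP [h1 h2]; lra.
pose cell d := [ffun k : 'I_m => inord (num d k) : 'I_B.+1].
have /choice [p pP] : forall i, exists d', D d' /\ forall d, D d -> cell d = i -> cell d' = i.
  move=> i; have [[d [Dd di]]|no] := pselect (exists d, D d /\ cell d = i).
    by exists d; split.
  by exists d0; split => // d Dd di; case: no; exists d.
exists {ffun 'I_m -> 'I_B.+1}, cell, p; split=> [i|d k Dd km]; first by have [] := pP i.
have [Dp /(_ d Dd erefl) pd] := pP (cell d); set d' := p (cell d) in Dp pd *.
have /(congr1 val) : cell d (Ordinal km) = cell d' (Ordinal km) by rewrite pd.
rewrite !ffunE /= !inordK ?numB // => numE.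
have /andP [l1 u1] := truncn_itv (g0 d k Dd); have /andP [l2 u2] := truncn_itv (g0 d' k Dp).
rewrite -/(num d k) in l1 u1; rewrite -/(num d' k) -numE in l2 u2.
move: l1 u1 l2 u2; rewrite -natr1; move: ((num d k)%:R) => x.
rewrite !ler_pdivlMr // !ltr_pdivrMr // mulrDl mul1r; move: (x * w) => y l1 u1 l2 u2.
by rewrite ltr_norml; apply/andP; split; lra.
Qed.

(** Lattice points [x] parametrise averages [pt x] of the values [t (p i)], which depend on [x] in a
    Lipschitz way however irregular [t] is. The colour of [x] is the cell of a point of [D] near
    [pt x]. Scarf's lemma then gives an [x] whose average puts weight only on cells [i] with [p i]
    close to [pt x] for the first [m] forms. *)
Lemma approximate_fixed_point (D : set E) (t : E -> E) (M : R) (g : nat -> E -> R)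
    m (eps : R) (d0 : E) :
  D d0 -> (forall d, D d -> `|d| <= M) -> (forall d, D d -> D (t d)) ->
  is_convex (closure D) -> (forall k, bounded_form 1 (g k)) -> 0 < eps ->
  exists d u, [/\ D d, `|d - u| < eps &
    hull [set t q | q in [set q | D q /\
      forall k, (k < m)%N -> `|g k d - g k q| < eps]] u].
Proof.
move=> Dd0 DM tD cD gb eps0; pose w := eps / 4.
have w0 : 0 < w by rewrite divr_gt0.
have M0 : 0 <= M by apply: le_trans (DM _ Dd0).
have [|I [cell [p [Dp cellp]]]] := @finite_net D M g m w d0 w0 Dd0.
  by move=> k d Dd; apply: le_trans ((gb k).2 d) _; rewrite mul1r DM.
(* Neighbours in [scarf_simplex] differ by at most [#|I| * #|I|.+1] in each of [#|I|] coordinates,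
   so their averages differ by at most [L / N], which the choice of [N] makes less than [w]. *)
pose L : R := (#|I| * (#|I| * #|I|.+1))%:R * M.
have L0 : 0 <= L by rewrite mulr_ge0 // ler0n.
pose N := (Num.truncn (L / w)).+1.
have N0 : 0 < N%:R :> R by rewrite ltr0n.
have LN : L / N%:R < w.
  by rewrite ltr_pdivrMr // mulrC -ltr_pdivrMr // truncnS_gt.
pose X := {ffun I -> 'I_N.+1}.
pose wt (x : X) i : R := (x i)%:R / N%:R.
pose pt (x : X) := \sum_i wt x i *: t (p i).
have pt_hull (Q : set E) (x : X) : (\sum_i x i)%N = N ->
    (forall i, (0 < x i)%N -> Q (t (p i))) -> hull Q (pt x).
  move=> xN xQ; exists [seq (wt x i, t (p i)) | i <- enum I & (0 < x i)%N].
    split=> [_ /mapP [i + ->]|].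
      by rewrite mem_filter => /andP [xi _]; split; [rewrite /wt divr_ge0|exact: xQ].
    rewrite big_map big_filter big_enum_cond /= big_mkcond /=.
    rewrite (eq_bigr (fun i => (x i)%:R / N%:R)); last first.
      by move=> i _; case: posnP => // ->; rewrite mul0r.
    by rewrite -mulr_suml -natr_sum xN divff ?gt_eqF.
  rewrite /barycenter big_map big_filter big_enum_cond /= [RHS]big_mkcond /=.
  by apply: eq_bigr => i _; case: posnP => //= xi; rewrite /wt xi mul0r scale0r.
have /choice [dx dxP] : forall x : X, exists d, D d /\ ((\sum_i x i)%N = N -> `|pt x - d| < w).
  move=> x; have [xN|xN] := pselect ((\sum_i x i)%N = N); last by exists d0.
  have : closure D (pt x).
    apply: (hull_sub_closed_convex _ cD (@subset_closure _ D)); first exact: closed_closure.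
    by apply: pt_hull => // i _; apply: tD.
  by move=> /closureE_norm /(_ _ w0) [d Dd dlt]; exists d.
have [x [xN xP]] := scarf_simplex (cell d0) (fun x => cell (dx x)).
have [Dd dlt] := dxP x.
have w_eps : w < eps by rewrite /w ltr_pdivrMr //; lra.
exists (dx x), (pt x); split => //.
  by rewrite distrC; apply: lt_trans (dlt xN) _.
apply: pt_hull => // i /xP [y [yN yi xy]].
exists (p i) => //; split; first exact: Dp.
move=> k km; have [Dy /(_ yN) ylt] := dxP y.
have ptxy : `|pt x - pt y| <= L / N%:R.
  rewrite /pt -sumrB; apply: le_trans (ler_norm_sum _ _ _) _.
  apply: le_trans (_ : \sum_(j : I) (#|I| * #|I|.+1)%:R / N%:R * M <= _).
    apply: ler_sum => j _; rewrite -scalerBl normrZ ler_pM //; last exact/DM/tD.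
    rewrite /wt -mulrBl normrM (ger0_norm (_ : 0 <= N%:R^-1)) ?invr_ge0 // ler_wpM2r ?invr_ge0 //.
    have [xy1 xy2] := xy j; rewrite ler_norml; apply/andP; split.
      by rewrite lerNl opprB lerBlDr -natrD addnC ler_nat.
    by rewrite lerBlDr -natrD addnC ler_nat.
  by rewrite sumr_const /L -mulr_natl natrM le_eqVlt; apply/orP; left; apply/eqP; ring.
(* Four errors of size [w] lead from [dx x] through [pt x], [pt y] and [dx y] to [p i]. *)
have h1 := bounded_form_dist (dx x) (pt x) (gb k).
have h2 := bounded_form_dist (pt x) (pt y) (gb k).
have h3 := bounded_form_dist (pt y) (dx y) (gb k).
have h4 := cellp (dx y) k Dy km; rewrite yi in h4.
have h5 := dlt xN; rewrite distrC in h5.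
have wE : eps = w + w + w + w by rewrite /w; lra.
rewrite !mul1r in h1 h2 h3.
have {}h1 := le_lt_trans h1 h5; have {}h2 := le_lt_trans (le_trans h2 ptxy) LN.
have {}h3 := le_lt_trans h3 ylt.
move: h1 h2 h3 h4; rewrite wE !ltr_norml => /andP [? ?] /andP [? ?] /andP [? ?] /andP [? ?].
by apply/andP; split; lra.
Qed.

End Approx.

(** * The measure of weak noncompactness *)

Section Bounded.
Variables (R : realType) (E : normedModType R).
Implicit Types W M K : set E.

Lemma bounded_setE M : bounded_set M <-> exists c, forall x, M x -> `|x| <= c.
Proof.
split=> [[c [_ cP]]|[c cP]].
  by exists (c + 1) => x Mx; apply: (cP (c + 1)) => //; rewrite ltrDl.
exists c; split; first exact: num_real.
by move=> r cr x Mx; apply: le_trans (cP x Mx) (ltW cr).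
Qed.

Lemma norm_le_set_norm M x : bounded_set M -> M x -> `|x| <= set_norm M.
Proof.
move=> /bounded_setE [c cP] Mx; apply: ub_le_sup; last by exists x.
by exists c => _ [y My <-]; exact: cP.
Qed.

Lemma set_norm_ge0 M : bounded_set M -> 0 <= set_norm M.
Proof.
move=> Mb; have [->|/set0P [x Mx]] := eqVneq M set0.
  by rewrite /set_norm image_set0 sup0.
exact: le_trans (norm_le_set_norm Mb Mx).
Qed.

Definition within_dist W K (e : R) := forall w, W w -> exists2 k, K k & `|w - k| <= e.

Lemma within_distE W K (e : R) : 0 < e ->
  W `<=` [set k + b | k in K & b in closed_ball (0 : E) e] <-> within_dist W K e.
Proof.
move=> e0; split=> [WK w /WK [k Kk [b]]|WK w /WK [k Kk wk]].
  rewrite closed_ballE // /closed_ball_ /= sub0r normrN => be <-.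
  by exists k; rewrite // addrC addKr.
exists k => //; exists (w - k); last by rewrite addrC subrK.
by rewrite closed_ballE // /closed_ball_ /= sub0r normrN.
Qed.

Lemma de_blasi_lbound W : has_lbound [set e : R | 0 < e /\ exists K : set E, weakly_compact K /\
    W `<=` [set k + b | k in K & b in closed_ball (0 : E) e]].
Proof. by exists 0 => e [/ltW]. Qed.

Lemma de_blasi_le W K (e : R) : 0 < e -> weakly_compact K -> within_dist W K e -> de_blasi W <= e.
Proof.
move=> e0 Kc WK; apply: ge_inf; first exact: de_blasi_lbound.
by split => //; exists K; split => //; apply/within_distE.
Qed.

Lemma weakly_compact1 (x : E) : weakly_compact [set x].
Proof. exact: compact_set1. Qed.

Lemma de_blasi_le_bound W (e : R) : 0 < e -> (forall w, W w -> `|w| <= e) -> de_blasi W <= e.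
Proof.
move=> e0 We; apply: (de_blasi_le e0 (@weakly_compact1 0)) => w Ww.
by exists 0 => //; rewrite subr0; exact: We.
Qed.

(* An unbounded set also has [de_blasi W = 0], as the infimum of the empty set. *)
Lemma lt_de_blasi W (e : R) : bounded_set W -> de_blasi W < e ->
  exists2 K, weakly_compact K & within_dist W K e.
Proof.
move=> /bounded_setE [c cP] We.
have [||e' [e'0 [K [Kc WK]]] e'e] := @inf_lt R [set e : R | 0 < e /\ exists K : set E,
  weakly_compact K /\ W `<=` [set k + b | k in K & b in closed_ball (0 : E) e]] e.
- have c1 : 0 < Num.max c 1 by rewrite lt_max ltr01 orbT.
  exists (Num.max c 1); split => //; exists [set 0]; split; first exact: weakly_compact1.
  by apply/within_distE => // w /cP wc; exists 0; rewrite // subr0 le_max wc.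
- exact: We.
- exists K => // w; move/(within_distE _ _ e'0): WK => /[apply] -[k Kk wk].
  by exists k => //; apply: le_trans wk (ltW e'e).
Qed.

Lemma de_blasi_ge0 W : 0 <= de_blasi W.
Proof.
rewrite /de_blasi; set X := [set _ | _]; have [->|/set0P X0] := eqVneq X set0.
  by rewrite inf0.
by apply: lb_le_inf => // e [/ltW].
Qed.

Lemma wcvg_comp (x : nat -> E) (e : nat -> nat) y : (forall n, (n <= e n)%N) ->
  wcvg \oo x y -> wcvg \oo (x \o e) y.
Proof.
move=> en xy f fb B /(xy f fb) [N _ NP]; exists N => // n /= Nn.
by apply: NP => /=; exact: leq_trans Nn (en n).
Qed.

Lemma wcvgD (x y : nat -> E) a b : wcvg \oo x a -> wcvg \oo y b ->
  wcvg \oo (fun n => x n + y n) (a + b).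
Proof.
move=> xa yb f fb; rewrite (linear_formD fb.1).
rewrite (_ : (fun n => _) = (fun n => f (x n) + f (y n))).
  by apply: cvgD; [exact: xa|exact: yb].
by apply/funext => n; rewrite (linear_formD fb.1).
Qed.

Lemma common_subseq m (x : nat -> nat -> E) :
  (forall i, (i < m)%N -> exists2 X, rel_weakly_compact X & forall n, X (x i n)) ->
  exists2 e : nat -> nat, (forall n, (n <= e n)%N) &
    forall i, (i < m)%N -> exists y, wcvg \oo (x i \o e) y.
Proof.
elim: m => [|m IHm] H; first by exists id.
have [i im|e en eP] := IHm; first by apply: H; exact: ltnW.
have [X Xc Xx] := H m (ltnSn m).
have [e' e'n [y ye']] := rel_weakly_compact_subseq Xc (fun n => Xx (e n)).
exists (e \o e') => [n|i]; first exact: leq_trans (e'n n) (en _).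
rewrite ltnS leq_eqVlt => /predU1P [->|im]; first by exists y.
by have [z ze] := eP i im; exists z; exact: (wcvg_comp e'n ze).
Qed.

End Bounded.

(** * Products in the Banach algebra *)

Section Product.
Variables (R : realType) (E : banachAlgType R).

Lemma bmulDl (x y z : E) : (x + y) *b z = x *b z + y *b z.
Proof. by have := bmul_linearl 1 x y z; rewrite !scale1r. Qed.

Lemma bmulDr (x y z : E) : z *b (x + y) = z *b x + z *b y.
Proof. by have := bmul_linearr 1 x y z; rewrite !scale1r. Qed.

Lemma bmul0r (z : E) : 0 *b z = 0.
Proof. by apply: (addIr (0 *b z)); rewrite -bmulDl !add0r. Qed.

Lemma bmulr0 (z : E) : z *b 0 = 0.
Proof. by apply: (addIr (z *b 0)); rewrite -bmulDr !add0r. Qed.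

Lemma bmulNl (x z : E) : (- x) *b z = - (x *b z).
Proof. by apply/eqP; rewrite -addr_eq0 -bmulDl addNr bmul0r. Qed.

Lemma bmulNr (x z : E) : z *b (- x) = - (z *b x).
Proof. by apply/eqP; rewrite -addr_eq0 -bmulDr addNr bmulr0. Qed.

(** Expanding around [a] and [b] uses their norms only, as [k] and [l] will come from compact sets
    without a given bound. The result has the shape of the growth condition. *)
Lemma norm_bmulB_le (a b k l : E) (NA NB r s : R) :
  `|a| <= NA -> `|b| <= NB -> `|a - k| <= r -> `|b - l| <= s ->
  `|a *b b - k *b l| <= NA * s + NB * r + r * s.
Proof.
move=> aN bN akr bls.
have -> : a *b b - k *b l = a *b (b - l) + (a - k) *b b - (a - k) *b (b - l).
  rewrite -[RHS]addrA -[X in _ = _ + (_ + X)]bmulNr -[X in _ = _ + X]bmulDr subKr.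
  by rewrite bmulDl bmulDr bmulNl bmulNr addrA subrK.
have mulle (x y : E) (p q : R) : `|x| <= p -> `|y| <= q -> `|x *b y| <= p * q.
  by move=> xp yq; apply: le_trans (ler_normM_bmul _ _) _; rewrite ler_pM.
apply: le_trans (ler_normB _ _) _; apply: lerD; last exact: mulle.
apply: le_trans (ler_normD _ _) _; apply: lerD; first exact: mulle.
by rewrite mulrC; exact: mulle.
Qed.

End Product.

(** * The countable orbit *)

Section Orbit.

(* Words name the points of the orbit, which makes it countable. *)
Inductive word := Start | Apply of word | Mid of word & word.

Fixpoint encode_word w : GenTree.tree unit :=
  match w with
  | Start => GenTree.Leaf tt
  | Apply v => GenTree.Node 0 [:: encode_word v]
  | Mid v v' => GenTree.Node 0 [:: encode_word v; encode_word v']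
  end.

Fixpoint decode_word (u : GenTree.tree unit) : option word :=
  match u with
  | GenTree.Leaf _ => Some Start
  | GenTree.Node _ [:: v] => omap Apply (decode_word v)
  | GenTree.Node _ [:: v; v'] =>
    if decode_word v is Some w then omap (Mid w) (decode_word v') else None
  | _ => None
  end.

Lemma encode_wordK : pcancel encode_word decode_word.
Proof. by elim=> //= [v ->|v -> v' ->]. Qed.

Variables (R : realType) (E : normedModType R) (x0 : E) (t : E -> E).

Fixpoint eval w : E :=
  match w with
  | Start => x0
  | Apply v => t (eval v)
  | Mid v v' => 2^-1 *: eval v + 2^-1 *: eval v'
  end.

Definition midpoint_orbit := range eval.

Lemma orbit_enum : exists x : nat -> E, range x = midpoint_orbit.
Proof.
exists (fun n => if unpickle n is Some u then
  (if decode_word u is Some w then eval w else x0) else x0).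
apply/seteqP; split=> [_ [n _ <-]|_ [w _ <-]].
  case: unpickle => [u|]; last by exists Start.
  by case: decode_word => [w|]; [exists w|exists Start].
by exists (pickle (encode_word w)); rewrite // pickleK encode_wordK.
Qed.

Lemma countable_orbit : countable midpoint_orbit.
Proof. by have [x <-] := orbit_enum; exact: card_image_le. Qed.

Lemma orbit_start : midpoint_orbit x0. Proof. by exists Start. Qed.

Lemma orbit_apply d : midpoint_orbit d -> midpoint_orbit (t d).
Proof. by move=> [w _ <-]; exists (Apply w). Qed.

Lemma orbit_mid d d' : midpoint_orbit d -> midpoint_orbit d' ->
  midpoint_orbit (2^-1 *: d + 2^-1 *: d').
Proof. by move=> [w _ <-] [w' _ <-]; exists (Mid w w'). Qed.

Lemma orbit_sub (Z : set E) : is_convex Z -> Z x0 -> (forall z, Z z -> Z (t z)) ->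
  midpoint_orbit `<=` Z.
Proof.
move=> /is_convexP cZ Zx0 tZ _ [w _ <-]; elim: w => //= [w|w Zw w' Zw']; first exact: tZ.
have := cZ _ _ 2^-1 Zw Zw'; rewrite (_ : 1 - 2^-1 = 2^-1); last by lra.
by apply; lra.
Qed.

End Orbit.

(** * Weakly compact approximation of the orbit *)

Section Estimate.
Variables (R : realType).

Lemma rel_weakly_compactU (E : normedModType R) (X Y : set E) :
  rel_weakly_compact X -> rel_weakly_compact Y -> rel_weakly_compact (X `|` Y).
Proof.
move=> Xc Yc U UU UXY; have [UX|UnX] := in_ultra_setVsetC X UU; first exact: Xc.
by apply: Yc; apply: filterS (filterI UXY UnX) => x [[]].
Qed.

Lemma rel_weakly_compact1 (E : normedModType R) (x : E) : rel_weakly_compact [set x].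
Proof. exact: weakly_compact_rel (@weakly_compact1 _ _ x). Qed.

Lemma rel_weakly_compact_de_blasi (E : completeNormedModType R) (W : set E) :
  bounded_set W -> de_blasi W <= 0 -> rel_weakly_compact W.
Proof.
move=> Wb W0; apply: rel_weakly_compact_approx => e e0.
have [K Kc WK] := lt_de_blasi Wb (le_lt_trans W0 e0).
by exists K => //; exact: weakly_compact_rel.
Qed.

Lemma weakly_compact_closed_hull (E : completeNormedModType R) (X : set E) :
  rel_weakly_compact (hull X) -> weakly_compact (closure (hull X)).
Proof.
move=> Xc; apply: rel_weakly_compact_closed; first exact: closed_closure.
  apply: closure_convex => a b q e Xa Xb q0 q1 e0.
  by exists (q *: a + (1 - q) *: b); [exact: hull_conv|rewrite subrr normr0].
apply: rel_weakly_compact_approx => e e0; exists (hull X) => // x.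
move=> /closureE_norm /(_ e e0) [y Xy xy].
by exists y => //; exact: ltW.
Qed.

Variable E : banachAlgType R.

Lemma wcvg_product (x y z : nat -> E) k l m : condition_P E ->
  wcvg \oo x k -> wcvg \oo y l -> wcvg \oo z m ->
  wcvg \oo (fun n => x n *b y n + z n) (k *b l + m).
Proof.
move=> hP /weakly_cvgE xk /weakly_cvgE yl zm.
by apply: wcvgD zm; apply/weakly_cvgE; exact: hP.
Qed.

Lemma orbit_within_dist (a b c : E -> E) (x0 : E) (KA KB KC : set E) (M NA NB r s q : R) :
  let D := midpoint_orbit x0 (fun x => a x *b b x + c x) in
  condition_P E ->
  (forall d, D d -> [/\ `|d| <= M, `|a d| <= NA & `|b d| <= NB]) ->
  rel_weakly_compact KA -> rel_weakly_compact KB -> rel_weakly_compact KC ->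
  (forall d, D d -> exists2 k, KA k & `|a d - k| <= r) ->
  (forall d, D d -> exists2 k, KB k & `|b d - k| <= s) ->
  (forall d, D d -> exists2 k, KC k & `|c d - k| <= q) ->
  exists2 K, weakly_compact K & within_dist D K (NA * s + NB * r + r * s + q).
Proof.
move=> D hP Dbd KAc KBc KCc DA DB DC; set e := _ + q.
have Dx0 : D x0 := orbit_start _ _.
have r0 : 0 <= r by have [k _] := DA _ Dx0; apply: le_trans.
have s0 : 0 <= s by have [k _] := DB _ Dx0; apply: le_trans.
have q0 : 0 <= q by have [k _] := DC _ Dx0; apply: le_trans.
have [M0 NA0 NB0] : [/\ 0 <= M, 0 <= NA & 0 <= NB].
  by have [h1 h2 h3] := Dbd _ Dx0; split; [exact: le_trans h1|exact: le_trans h2|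
    exact: le_trans h3].
have e0 : 0 <= e by rewrite !addr_ge0 // mulr_ge0.
(* The points 0 and [x0] are added so that the start [0 *b 0 + x0] is in [P]. The norm bound, which
   [krein] requires, is imposed because no bound for [KA], [KB] and [KC] is at hand; points within
   [e] of [D] satisfy it. *)
pose P := [set z : E | `|z| <= M + e /\ exists k l m, [/\ (KA `|` [set 0]) k,
  (KB `|` [set 0]) l, (KC `|` [set x0]) m & z = k *b l + m]].
have Pc : rel_weakly_compact (hull P).
  apply: (krein (M := M + e)) => [z []//|z Pz].
  have /choice [k kP] : forall n, exists k, exists l m, [/\ (KA `|` [set 0]) k,
    (KB `|` [set 0]) l, (KC `|` [set x0]) m & z n = k *b l + m].
    by move=> n; have [_ [k [l [m H]]]] := Pz n; exists k, l, m.
  have /choice [l lP] := kP; have /choice [m mP] := lP.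
  have U1 (X : set E) x : rel_weakly_compact X -> rel_weakly_compact (X `|` [set x]).
    by move=> Xc; apply: rel_weakly_compactU => //; exact: rel_weakly_compact1.
  have [i i3|f fn fP] := @common_subseq R E 3 (nth z [:: k; l; m]).
    case: i i3 => [|[|[|//]]] _ /=.
    - by exists (KA `|` [set 0]) => [|n]; [exact: U1|case: (mP n)].
    - by exists (KB `|` [set 0]) => [|n]; [exact: U1|case: (mP n)].
    - by exists (KC `|` [set x0]) => [|n]; [exact: U1|case: (mP n)].
  have [k' kk'] := fP 0%N isT; have [l' ll'] := fP 1%N isT; have [m' mm'] := fP 2%N isT.
  exists f => //; exists (k' *b l' + m').
  rewrite (_ : z \o f = (fun n => (k \o f) n *b (l \o f) n + (m \o f) n)).
    exact: wcvg_product.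
  by apply/funext => n /=; have [_ _ _ ->] := mP (f n).
exists (closure (hull P)); first exact: weakly_compact_closed_hull.
suff DP w : exists2 u, hull P u & `|eval x0 (fun x => a x *b b x + c x) w - u| <= e.
  by move=> _ [w _ <-]; have [u Pu wu] := DP w; exists u => //; exact: subset_closure.
(* Errors do not accumulate: a value of [t] is approximated afresh, without the induction
   hypothesis, and midpoints do not increase the distance to a convex set. *)
elim: w => [|w _|w [u Pu wu] w' [u' Pu' wu']] /=.
- exists x0; last by rewrite subrr normr0.
  apply: sub_hull; split; first by have [h _ _] := Dbd _ Dx0; rewrite (le_trans h) // lerDl.
  exists 0, 0, x0; split; [by right|by right|by right|by rewrite bmul0r add0r].
- set d := eval _ _ _; have Dd : D d by exists w.
  have [h1 h2 h3] := Dbd d Dd.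
  have [k Kk dk] := DA d Dd; have [l Kl dl] := DB d Dd; have [m Km dm] := DC d Dd.
  have dist : `|a d *b b d + c d - (k *b l + m)| <= e.
    rewrite opprD addrACA; apply: le_trans (ler_normD _ _) _; apply: lerD => //.
    exact: norm_bmulB_le.
  exists (k *b l + m) => //; apply: sub_hull; split; last by exists k, l, m; split => //; left.
  have [h4 _ _] := Dbd _ (orbit_apply Dd).
  rewrite -(subKr (a d *b b d + c d) (k *b l + m)).
  by apply: le_trans (ler_normB _ _) _; apply: lerD.
- exists (2^-1 *: u + 2^-1 *: u').
    have := hull_conv (t := 2^-1) Pu Pu'; rewrite (_ : 1 - 2^-1 = 2^-1 :> R); last by lra.
    by apply; lra.
  rewrite opprD addrACA -!scalerBr; apply: le_trans (ler_normD _ _) _.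
  rewrite !normrZ (ger0_norm (_ : 0 <= 2^-1)) ?invr_ge0 //.
  by move: wu wu'; move: (`|eval _ _ _ - u|) (`|eval _ _ _ - u'|) => x y; lra.
Qed.

End Estimate.

(** The infimum defining the measure need not be attained, so the radii of covers exceed the values
    of the [Phi] by some [h]. For [h <= 1] the left side grows by at most [h * c], and
    [gap / (c *+ 2)] keeps this within half the gap. *)
Lemma strict_slack (R : realType) (NA NB p q s r : R) :
  0 <= NA -> 0 <= NB -> 0 <= p -> 0 <= q -> 0 <= s ->
  NB * p + NA * q + p * q + s < r ->
  exists2 h, 0 < h & NA * (q + h) + NB * (p + h) + (p + h) * (q + h) + (s + h) < r.
Proof.
move=> NA0 NB0 p0 q0 s0 ltr.
pose c := NA + NB + p + q + 2; pose gap := r - (NB * p + NA * q + p * q + s).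
have c0 : 0 < c by rewrite /c; lra.
have gap0 : 0 < gap by rewrite subr_gt0.
pose h := Num.min 1 (gap / (c *+ 2)).
have h0 : 0 < h by rewrite lt_min ltr01 divr_gt0 // pmulrn_lgt0.
have h1 : h <= 1 by rewrite ge_min lexx.
have h2 : h * c *+ 2 <= gap.
  by rewrite -mulrnAr -ler_pdivlMr ?pmulrn_lgt0 // ge_min lexx orbT.
exists h => //; have hh : h * h <= h by rewrite ger_pMl.
have -> : NA * (q + h) + NB * (p + h) + (p + h) * (q + h) + (s + h) =
  r - gap + h * c + (h * h - h) by rewrite /c /gap; ring.
by move: h2; rewrite mulr2n; lra.
Qed.

(** * The decreasing sequence of closed convex hulls *)

Section HullSeq.
Variables (R : realType) (E : normedModType R) (S : set E) (T : E -> set E).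
Hypotheses (S0 : S !=set0) (clS : closed S) (cS : is_convex S)
  (TS : forall u, S u -> T u `<=` S) (T0 : forall u, S u -> T u !=set0).

Lemma hull_seq_closed n : closed (hull_seq S T n).
Proof. by case: n => // n; exact: closed_hull. Qed.

Lemma hull_seq_convex n : is_convex (hull_seq S T n).
Proof. by case: n => // n; exact: is_convex_hull. Qed.

Lemma hull_seqS n : hull_seq S T n.+1 `<=` hull_seq S T n.
Proof.
elim: n => [|n IHn]; apply: closed_hull_min.
- exact: clS.
- exact: cS.
- by move=> y [u Su]; exact: TS.
- exact: closed_hull.
- exact: is_convex_hull.
- by move=> y [u Su Tuy]; apply: sub_closed_hull; exists u => //; exact: IHn.
Qed.

Lemma hull_seq_sub n : hull_seq S T n `<=` S.
Proof. by elim: n => // n IHn; exact: subset_trans (@hull_seqS n) IHn. Qed.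

Lemma hull_seq_invariant n u : hull_seq S T n u -> T u `<=` hull_seq S T n.
Proof.
by move=> nu y Tuy; apply: hull_seqS; apply: sub_closed_hull; exists u.
Qed.

Lemma hull_seq_nonempty n : hull_seq S T n !=set0.
Proof.
elim: n => //= n [u nu]; have [y Tuy] := T0 (hull_seq_sub nu).
by exists y; apply: sub_closed_hull; exists u.
Qed.

End HullSeq.

(** * Passage to the limit in the approximate fixed points *)

Section FixedPoint.
Variables (R : realType) (E : banachAlgType R).

Lemma hull_exists_lt (P : set E) f (m : R) u : linear_form f -> hull P u -> f u < m ->
  exists2 z, P z & f z < m.
Proof.
move=> fl [s sP ->]; rewrite form_barycenter // => lt; apply: contrapT => H.
move: lt; rewrite ltNge => /negP; apply.
have : \sum_(p <- s) p.1 * m <= \sum_(p <- s) p.1 * f p.2.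
  apply: (weighting_sum_le sP) => p Pp; rewrite leNgt; apply/negP => lt.
  by apply: H; exists p.2.
by rewrite -mulr_suml sP.2 mul1r.
Qed.

(** If [y] were outside its value, some form [f] would be at least [f y + dl] on that value.
    Averages of points [t q] approach [y], so some of these points satisfy [f (t q) < f y + dl / 2].
    Along a subsequence such [q] tend weakly to [y], and by the closed graphs and condition (P) the
    [t q] tend weakly to a point of the value of [y], a contradiction. *)
Theorem orbit_fixed_point (S : set E) (A B C : E -> set E) (a b c : E -> E) (x0 : E) (M : R) :
  let t x := a x *b b x + c x in
  let D := midpoint_orbit x0 t in
  condition_P E -> closed S -> is_convex S -> D `<=` S ->
  weakly_seq_closed_graph S A -> weakly_seq_closed_graph S B -> weakly_seq_closed_graph S C ->
  (forall u, S u -> closed (mv_mul_add A B C u) /\ is_convex (mv_mul_add A B C u)) ->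
  (forall d, D d -> [/\ A d (a d), B d (b d) & C d (c d)]) ->
  (forall d, D d -> `|d| <= M) ->
  rel_weakly_compact D -> rel_weakly_compact (mv_image A D) ->
  rel_weakly_compact (mv_image B D) -> rel_weakly_compact (mv_image C D) ->
  exists2 y, closed_convex_hull D y & mv_mul_add A B C y y.
Proof.
move=> t D hP clS cS DS Agr Bgr Cgr Tcl sel DM Dc ADc BDc CDc.
have [x xD] := orbit_enum x0 t.
have [g gb gsep] := separating_forms x; rewrite xD -/D in gsep.
have cD : is_convex (closure D).
  by apply: closure_midpoint_convex => u v; exact: orbit_mid.
have inv0 n : 0 < n.+1%:R^-1 :> R by rewrite invr_gt0 ltr0n.
have /choice [d /choice [u duP]] : forall n : nat, exists d u, [/\ D d, `|d - u| < n.+1%:R^-1 &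
    hull [set t q | q in [set q | D q /\
      forall k, (k < n)%N -> `|g k d - g k q| < n.+1%:R^-1]] u].
  move=> n; exact: (@approximate_fixed_point R E D t M g n _ x0 (orbit_start x0 t) DM
    (@orbit_apply R E x0 t) cD gb (inv0 n)).
have [e0 e0n [y dy]] := rel_weakly_compact_subseq Dc (fun n => (let: And3 h _ _ := duP n in h)).
have Dhull T (U : set_system T) (h : T -> E) w : ProperFilter U -> (forall i, D (h i)) ->
    wcvg U h w -> closed_convex_hull D w.
  move=> PU hD; apply: wcvg_closed_hull => //.
  by apply: filterS (filterT : U setT) => i _; exact: hD.
have yD : closed_convex_hull D y by apply: (Dhull _ _ _ _ _ _ dy) => n; have [] := duP (e0 n).
have SD w : closed_convex_hull D w -> S w by exact: closed_hull_min.
have Sy : S y := SD y yD.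
exists y => //; have [Tycl Tyc] := Tcl y Sy.
apply: contrapT => nTy; have [f fb [dl dl0 fT]] := separation Tyc Tycl nTy.
have /choice [j /choice [q jqP]] : forall N, exists j q, [/\ (N <= j)%N, D q,
    forall k, (k < N)%N -> `|g k (d (e0 j)) - g k q| < N.+1%:R^-1 & f (t q) < f y + dl / 2].
  move=> N; have dl4 : 0 < dl / 4 by rewrite divr_gt0.
  have fdy : f (d (e0 j)) @[j --> \oo] --> f y := dy f fb.
  have /cvgrPdist_lt /(_ _ dl4) near1 := fdy.
  have near2 := near_infty_natSinv_lt (PosNum dl4).
  have near3 : \oo [set j | (N <= j)%N] by exists N.
  have [j [/= [h1 h2] Nj]] := filter_ex (filterI (filterI near1 near2) near3).
  have [Dd du uhull] := duP (e0 j).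
  have inv_le m : (m <= e0 j)%N -> (e0 j).+1%:R^-1 <= m.+1%:R^-1 :> R.
    by move=> mj; rewrite lef_pV2 ?posrE ?ltr0n // ler_nat.
  have fu : f (u (e0 j)) < f y + dl / 2.
    have := bounded_form_dist (d (e0 j)) (u (e0 j)) fb; rewrite mul1r => h3.
    have h4 := lt_trans (le_lt_trans h3 (lt_le_trans du (inv_le j (e0n j)))) h2.
    by move: h1 h4; rewrite !ltr_norml => /andP [? ?] /andP [? ?]; lra.
  have [_ [z [Dz zg] <-] ft] := hull_exists_lt fb.1 uhull fu.
  exists j, z; split => // k kN; apply: lt_le_trans (zg k _) (inv_le N _).
    exact: leq_trans kN (leq_trans Nj (e0n j)).
  exact: leq_trans Nj (e0n j).
have qD N : D (q N) by have [] := jqP N.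
have [i i4|e en eP] := @common_subseq R E 4 (nth q [:: q; a \o q; b \o q; c \o q]).
  case: i i4 => [|[|[|[|//]]]] _ /=.
  - by exists D.
  - by exists (mv_image A D) => // n; exists (q n) => //; have [] := sel _ (qD n).
  - by exists (mv_image B D) => // n; exists (q n) => //; have [] := sel _ (qD n).
  - by exists (mv_image C D) => // n; exists (q n) => //; have [] := sel _ (qD n).
have [z qz] := eP 0%N isT; have [k ak] := eP 1%N isT.
have [l bl] := eP 2%N isT; have [m cm] := eP 3%N isT.
(* [q N] follows [d (e0 (j N))] on the first [N] forms up to [N.+1%:R^-1], and both limits lie in
   the closed hull of [D], where these forms separate points. *)
have zy : z = y.
  apply: gsep => [||i].
  - by apply: (Dhull _ _ _ _ _ _ qz) => n; exact: qD.
  - exact: yD.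
  have dj : wcvg \oo (d \o e0 \o (j \o e)) y.
    apply: wcvg_comp dy => n; have [h _ _ _] := jqP (e n).
    exact: leq_trans (en n) h.
  apply: (cvgR_unique _ (qz _ (gb i))); apply/cvgrPdist_lt => eps eps0.
  have eps2 : 0 < eps / 2 by rewrite divr_gt0.
  have /cvgrPdist_lt /(_ _ eps2) near1 := dj _ (gb i).
  have near2 := near_infty_natSinv_lt (PosNum eps2).
  have near3 : \oo [set n | (i < n)%N] by exists i.+1.
  apply: filterS (filterI (filterI near1 near2) near3) => n [/= [h1 h2] ni].
  have [_ _ /(_ i (leq_trans ni (en n))) h3 _] := jqP (e n).
  have h4 : (e n).+1%:R^-1 < eps / 2 :> R.
    by apply: le_lt_trans h2; rewrite lef_pV2 ?posrE ?ltr0n // ler_nat ltnS.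
  have {h4}h3 := lt_trans h3 h4.
  by move: h1 h3; rewrite !ltr_norml => /andP [? ?] /andP [? ?]; apply/andP; split; lra.
subst z.
have graph (F : E -> set E) (h : E -> E) v : weakly_seq_closed_graph S F ->
    (forall n, F (q n) (h (q n))) -> wcvg \oo (h \o q \o e) v -> F y v.
  move=> Fgr Fq /weakly_cvgE hv; apply: (Fgr (q \o e) (h \o q \o e)) => //.
  - by move=> n; exact/DS/qD.
  - exact/weakly_cvgE.
  - by move=> n; exact: Fq.
have Tkl : mv_mul_add A B C y (k *b l + m).
  exists k, l, m; split => //.
  - by apply: (graph A a) => // n; have [] := sel _ (qD n).
  - by apply: (graph B b) => // n; have [] := sel _ (qD n).
  - by apply: (graph C c) => // n; have [] := sel _ (qD n).
have := fT _ Tkl; apply/negP; rewrite -ltNge.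
have tq : wcvg \oo (t \o q \o e) (k *b l + m) := wcvg_product hP ak bl cm.
have : f (k *b l + m) <= f y + dl / 2.
  apply: (le_of_cvg _ (tq f fb)); exists 0%N => // n _ /=.
  by have [_ _ _ h] := jqP (e n); exact: ltW.
by move/le_lt_trans; apply; lra.
Qed.

End FixedPoint.

Theorem theorem4p1 (R : realType) (E : banachAlgType R)
    (S Omega : set E) (A B C : E -> set E) (PhiA PhiB PhiC : R -> R)
    (hP : condition_P E)
    (hS0 : S !=set0) (hScl : closed S) (hScv : is_convex S)
    (hA : multivalued S A) (hB : multivalued S B) (hC : multivalued S C)
    (hAgraph : weakly_seq_closed_graph S A)
    (hBgraph : weakly_seq_closed_graph S B)
    (hCgraph : weakly_seq_closed_graph S C)
    (hABC : forall u, S u ->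
       [/\ closed (mv_mul_add A B C u), is_convex (mv_mul_add A B C u) &
           mv_mul_add A B C u `<=` S])
    (hOmega : exists n : nat, Omega = hull_seq S (mv_mul_add A B C) n)
    (hOmega_bounded : bounded_set Omega)
    (hALip : countably_D_set_Lipschitzian Omega A PhiA)
    (hBLip : countably_D_set_Lipschitzian Omega B PhiB)
    (hCLip : countably_D_set_Lipschitzian Omega C PhiC)
    (hAbounded : bounded_set (mv_image A Omega))
    (hBbounded : bounded_set (mv_image B Omega))
    (hPhi : forall r : R, 0 < r -> r <= set_norm Omega ->
       set_norm (mv_image B Omega) * PhiA r
       + set_norm (mv_image A Omega) * PhiB r
       + PhiA r * PhiB r + PhiC r < r) :
  exists x, Omega x /\ mv_mul_add A B C x x.
Proof.
set T := mv_mul_add A B C in hABC hOmega *.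
have TS u : S u -> T u `<=` S by move=> /hABC [].
have T0 u : S u -> T u !=set0.
  move=> Su; have [k Ak] := hA u Su; have [l Bl] := hB u Su; have [m Cm] := hC u Su.
  by exists (k *b l + m), k, l, m.
have [clO cO OS TO [x0 Ox0]] : [/\ closed Omega, is_convex Omega, Omega `<=` S,
    forall u, Omega u -> T u `<=` Omega & Omega !=set0].
  have [n ->] := hOmega; split.
  - exact: hull_seq_closed.
  - exact: hull_seq_convex.
  - exact: hull_seq_sub.
  - exact: hull_seq_invariant.
  - exact: hull_seq_nonempty.
have select (F : E -> set E) : multivalued S F -> exists f : E -> E, forall u, S u -> F u (f u).
  move=> hF; have /choice [f fP] : forall u, exists v, S u -> F u v.
    by move=> u; have [/hF [v Fv]|nSu] := pselect (S u); [exists v|exists u].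
  by exists f.
have [a aA] := select A hA; have [b bB] := select B hB; have [c cC] := select C hC.
pose t x := a x *b b x + c x; pose D := midpoint_orbit x0 t.
have DO : D `<=` Omega.
  apply: orbit_sub => // z Oz; apply: TO (Oz) _ _; have Sz := OS z Oz.
  by exists (a z), (b z), (c z); split; [exact: aA|exact: bB|exact: cC|].
have DS : D `<=` S by exact: subset_trans OS.
have subb (X Y : set E) : X `<=` Y -> bounded_set Y -> bounded_set X.
  by move=> XY /bounded_setE [k kP]; apply/bounded_setE; exists k => x /XY; exact: kP.
have imageS (F : E -> set E) : mv_image F D `<=` mv_image F Omega.
  by move=> v [u Du Fuv]; exists u => //; exact: DO.
have Db : bounded_set D := subb _ _ DO hOmega_bounded.
have ADb : bounded_set (mv_image A D) := subb _ _ (imageS A) hAbounded.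
have BDb : bounded_set (mv_image B D) := subb _ _ (imageS B) hBbounded.
set NA := set_norm (mv_image A Omega) in hPhi *; set NB := set_norm (mv_image B Omega) in hPhi *.
have NA0 : 0 <= NA by exact: set_norm_ge0.
have NB0 : 0 <= NB by exact: set_norm_ge0.
have aNA d : D d -> `|a d| <= NA.
  by move=> Dd; apply: norm_le_set_norm => //; exists d; [exact: DO|exact/aA/DS].
have bNB d : D d -> `|b d| <= NB.
  by move=> Dd; apply: norm_le_set_norm => //; exists d; [exact: DO|exact/bB/DS].
(* A value [m] of [C] at [d] is the point [a d *b b d + m] of the bounded set [Omega] minus a
   product of bounded factors. *)
have CDb : bounded_set (mv_image C D).
  apply/bounded_setE; exists (set_norm Omega + NA * NB) => m [d Dd Cdm].
  have : Omega (a d *b b d + m).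
    by apply: (TO d (DO d Dd)); exists (a d), (b d), m; split => //; [exact/aA/DS|exact/bB/DS].
  move=> /(norm_le_set_norm hOmega_bounded) h1.
  rewrite -(addKr (a d *b b d) m) addrC; apply: le_trans (ler_normB _ _) _; apply: lerD => //.
  by apply: le_trans (ler_normM_bmul _ _) _; rewrite ler_pM // ?aNA ?bNB.
have Dcount : countable D by exact: countable_orbit.
have [[PhiA0 _ _ PhiA00] /(_ D DO Dcount Db ADb) leA] := hALip.
have [[PhiB0 _ _ PhiB00] /(_ D DO Dcount Db BDb) leB] := hBLip.
have [[PhiC0 _ _ PhiC00] /(_ D DO Dcount Db CDb) leC] := hCLip.
have OM d : D d -> `|d| <= set_norm Omega by move=> /DO; exact: norm_le_set_norm.
have D0 : de_blasi D = 0.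
  have := de_blasi_ge0 D; rewrite le_eqVlt => /predU1P [->//|r0].
  set r := de_blasi D in r0 leA leB leC *.
  (* [D] lies in the ball of radius [set_norm Omega] about 0; adding [e] makes the radius positive.
     This admits [r] in the growth condition. *)
  have rO : r <= set_norm Omega.
    apply/ler_addgt0Pr => e e0; apply: de_blasi_le_bound => [|d /OM dO].
      by rewrite ltr_wpDl // set_norm_ge0.
    by rewrite (le_trans dO) // lerDl ltW.
  have [h h0 hlt] := strict_slack NA0 NB0 (PhiA0 r (ltW r0)) (PhiB0 r (ltW r0))
    (PhiC0 r (ltW r0)) (hPhi r r0 rO).
  have cover F Phi (f : E -> E) : bounded_set (mv_image F D) ->
      de_blasi (mv_image F D) <= Phi r -> (forall u, S u -> F u (f u)) ->
      exists2 K, rel_weakly_compact K & forall d, D d -> exists2 k, K k & `|f d - k| <= Phi r + h.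
    move=> FDb lePhi fF; have [|K Kc FK] := lt_de_blasi FDb (_ : _ < Phi r + h).
      by rewrite (le_lt_trans lePhi) // ltrDl.
    exists K; first exact: weakly_compact_rel.
    by move=> d Dd; apply: FK; exists d => //; exact/fF/DS.
  have [KA KAc DA] := cover A PhiA a ADb leA aA.
  have [KB KBc DB] := cover B PhiB b BDb leB bB.
  have [KC KCc DC] := cover C PhiC c CDb leC cC.
  have Dbd d : D d -> [/\ `|d| <= set_norm Omega, `|a d| <= NA & `|b d| <= NB].
    by move=> Dd; split; [exact: OM|exact: aNA|exact: bNB].
  have [K Kc DK] := @orbit_within_dist R E a b c x0 KA KB KC (set_norm Omega) NA NB _ _ _
    hP Dbd KAc KBc KCc DA DB DC.
  have e0 : 0 < NA * (PhiB r + h) + NB * (PhiA r + h)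
      + (PhiA r + h) * (PhiB r + h) + (PhiC r + h).
    have h1 := PhiA0 r (ltW r0); have h2 := PhiB0 r (ltW r0); have h3 := PhiC0 r (ltW r0).
    by rewrite ltr_wpDl ?ltr_wpDl // !addr_ge0 // mulr_ge0 // addr_ge0 // ltW.
  by have := le_lt_trans (de_blasi_le e0 Kc DK) hlt; rewrite ltxx.
(* As the [Phi] vanish at 0, the measures of the three images of [D] vanish as well. *)
rewrite D0 ?PhiA00 ?PhiB00 ?PhiC00 in leA leB leC.
have Tcl u : S u -> closed (T u) /\ is_convex (T u) by move=> /hABC [].
have sel d : D d -> [/\ A d (a d), B d (b d) & C d (c d)].
  by move=> /DS Sd; split; [exact: aA|exact: bB|exact: cC].
have [||||y yD Ty] := @orbit_fixed_point R E S A B C a b c x0 (set_norm Omega) hP hScl hScv DS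
  hAgraph hBgraph hCgraph Tcl sel OM.
- by apply: rel_weakly_compact_de_blasi; rewrite // D0.
- exact: rel_weakly_compact_de_blasi.
- exact: rel_weakly_compact_de_blasi.
- exact: rel_weakly_compact_de_blasi.
by exists y; split => //; exact: (closed_hull_min clO cO DO).
Qed.
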